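(* Let $\alpha>0$ and let $\psi\in C^0([-1,1];(0,\infty))$ satisfy $\psi(1)=\psi(-1)>\alpha$ and $\psi(x)=\psi(-x)$ for all $x\in(-1,1)$. Assume that $$\inf_{v\in N_\alpha(\psi)}W(v)<4\pi .$$ Then there exists $u\in N_\alpha(\psi)$ such that $$W(u)=\inf_{v\in N_\alpha(\psi)}W(v).$$
   Context: The admissible sets are $$N_\alpha=\{v\in H^2((-1,1);(0,\infty))\mid v(1)=v(-1)=\alpha,\ v'(1)=v'(-1)=0,\ v(x)=v(-x)\ \text{for all }x\in[-1,1]\},$$ $$N_\alpha(\psi)=\{v\in N_\alpha\mid v(x)\le\psi(x)\ \text{for all }x\in[-1,1]\}.$$ The Willmore functional of the surface of revolution obtained by rotating the graph of $v$ around the $x$-axis is $$W(v)=\frac{\pi}{2}\int_{-1}^1\left(\frac{1}{v(x)\sqrt{1+v'(x)^2}}-\frac{v''(x)}{(1+v'(x)^2)^{3/2}}\right)^2v(x)\sqrt{1+v'(x)^2}\,dx .$$ *)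

(* Defs.v *)
From HB Require Import structures.
From mathcomp Require Import all_boot all_order all_algebra.
From mathcomp Require Import all_classical all_reals all_analysis.

Set Implicit Arguments.
Unset Strict Implicit.
Unset Printing Implicit Defensive.

Import Order.TTheory GRing.Theory Num.Theory.
Import numFieldNormedType.Exports.

Local Open Scope classical_set_scope.
Local Open Scope ring_scope.

(* Functions on [-1, 1] are functions R -> R whose values outside [-1, 1] are
   irrelevant. Sobolev spaces on (-1, 1) are defined as in Brezis, Functional
   Analysis, Sobolev Spaces and Partial Differential Equations, Chapter 8: weak
   derivatives are tested against C^1 functions with compact support, and H^2
   consists of the functions of H^1 whose weak derivative is in H^1. *)

Section Sobolev.
Context {R : realType}.
Implicit Types f g phi : R -> R.

Let mu := @lebesgue_measure R.

Definition oitv : set R := `]-1, 1[.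
Definition citv : set R := `[-1, 1].

Definition L2 f : Prop := f \_ oitv \in Lfun mu 2%:E.

Definition test_function phi : Prop :=
  [/\ forall x, derivable phi x 1,
      continuous (derive1 phi)
    & exists a b : R, [/\ -1 < a, b < 1 & forall x, x \notin `[a, b] -> phi x = 0]].

Definition is_weak_derivative f g : Prop :=
  forall phi, test_function phi ->
    \int[mu]_(x in oitv) (f x * derive1 phi x) =
    - \int[mu]_(x in oitv) (g x * phi x).

Definition H1 f : Prop :=
  L2 f /\ exists2 g, L2 g & is_weak_derivative f g.

(* A choice of the weak derivative, which is unique almost everywhere. *)
Definition weak_derivative f : R -> R :=
  xget (cst 0) [set g | L2 g /\ is_weak_derivative f g].

Definition H2 f : Prop := H1 f /\ H1 (weak_derivative f).

(* The representative of f that is continuous up to the boundary, when there is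
   one (in particular if f is in H^1); it is then unique on [-1, 1]. *)
Definition continuous_repr f : R -> R :=
  xget (cst 0) [set g | {within citv, continuous g} /\
                        {ae mu, forall x, x \in oitv -> g x = f x}].

End Sobolev.

Section Willmore.
Context {R : realType}.
Implicit Types (alpha : R) (psi v : R -> R).

(* v itself is the continuous representative, and the boundary values of v' are
   those of the continuous representative of the weak derivative. *)
Definition admissible alpha : set (R -> R) :=
  [set v | [/\ H2 v /\ {within citv, continuous v},
               forall x, x \in oitv -> 0 < v x,
               v 1 = alpha /\ v (-1) = alpha,
               let dv := continuous_repr (weak_derivative v) in
               dv 1 = 0 /\ dv (-1) = 0
             & forall x, x \in citv -> v x = v (- x)]].

Definition obstacle_admissible alpha psi : set (R -> R) :=
  [set v | admissible alpha v /\ forall x, x \in citv -> v x <= psi x].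

(* The integrand is nonnegative on (-1, 1) when v is positive there, so the
   functional is taken with values in the extended reals. *)
Definition Willmore v : \bar R :=
  let dv := weak_derivative v in
  let ddv := weak_derivative dv in
  ((pi / 2)%:E *
   \int[@lebesgue_measure R]_(x in oitv)
     ((1 / (v x * Num.sqrt (1 + dv x ^+ 2))
       - ddv x / (1 + dv x ^+ 2) `^ (3 / 2)) ^+ 2
      * (v x * Num.sqrt (1 + dv x ^+ 2)))%:E)%E.

End Willmore.

(* Main.v *)
(* Write p = v', q = v'' and S = sqrt (1 + p^2). Expanding the square in W, the
   cross term integrates to zero because q / S^3 is the derivative of p / S and
   p vanishes at both ends, so W = (pi / 2) E with
   E = \int v q^2 / S^5 + 1 / (v S).
   By AM-GM, E is at least twice the total variation of p / S; as p is odd and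
   vanishes at -1, 0 and 1, this variation is at least 4 max |p / S|. Hence
   E <= E0 < 8 keeps |p| / S away from 1, which bounds p; then \int 1 / v is
   bounded, so |ln v| is bounded because (ln v)' = p / v, and finally \int q^2 is
   bounded. A minimizing sequence is thus bounded in H^2 and bounded below by a
   positive constant. Its values and those of its derivatives converge pointwise
   along an ultrafilter, Riemann sums show that E is lower semicontinuous along
   this convergence, and the second derivative of the limit is the L^2 limit of
   the dyadic difference quotients of p, which form a bounded martingale. *)

Require Import Defs.
From mathcomp Require Import all_boot all_order all_algebra.
From mathcomp Require Import all_classical all_reals all_analysis.
From mathcomp Require Import measurable_realfun ring lra.
Import Order.TTheory GRing.Theory Num.Theory.
Import numFieldNormedType.Exports.
Local Open Scope classical_set_scope.
Local Open Scope ring_scope.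

Set Implicit Arguments.
Unset Strict Implicit.

(** * Integrals over intervals, primitives and the chain rule *)

Section Integral.
Context {R : realType}.
Local Notation mu := (@lebesgue_measure R).
Implicit Types (f g : R -> R) (x y z a b c : R).

(** The constant 4 pi is (pi / 2) * 8. The ratio p / S is the sine of the inclination of the profile
    curve, so four excursions between 0 and its maximum would cost energy 8 if the tangent became
    vertical; below that level the graphs stay uniformly away from vertical. The obstacle is the
    passage to the limit. An ultrafilter settles all points at once, but integrals cannot be carried
    along it by dominated convergence, which concerns sequences. Each property of the minimizing
    sequence is therefore first turned into inequalities between values at finitely many points,
    with a modulus of continuity common to all its members: Taylor remainders express that p is the
    derivative of v, dyadic difference quotients carry the bound on the integral of q^2, and Riemann
    sums carry the energy. Measure theory returns only for the limit function, whose dyadic step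
    functions do form a sequence. *)

Definition locint f :=
  measurable_fun [set: R] f /\
  forall a b, mu.-integrable `]a, b] (EFin \o f).

(** Half-open intervals concatenate without overlap. When [y <= x] the interval is empty and the
    value is 0, not a signed integral; hence the ordered endpoints in additivity and in most
    estimates. *)
Definition itg f x y : R := \int[mu]_(t in `]x, y]) f t.

Lemma locint_mfun f : locint f -> measurable_fun [set: R] f.
Proof. by case. Qed.

Lemma locint_itv f a b : locint f -> mu.-integrable `]a, b] (EFin \o f).
Proof. by case. Qed.

Lemma locintD f g : locint f -> locint g -> locint (fun x => f x + g x).
Proof.
move=> [mf intf] [mg intg]; split; first exact: measurable_funD.
by move=> a b; exact: (integrableD _ (intf a b) (intg a b)).
Qed.

Lemma locintZ k f : locint f -> locint (fun x => k * f x).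
Proof.
move=> [mf intf]; split; first exact: measurable_funM.
by move=> a b; exact: (@integrableZl _ _ _ mu _ _ k _ (intf a b)).
Qed.

Lemma locintN f : locint f -> locint (fun x => - f x).
Proof.
move=> /(locintZ (-1)); congr locint; apply/funext => x.
by rewrite mulN1r.
Qed.

Lemma locintB f g : locint f -> locint g -> locint (fun x => f x - g x).
Proof. by move=> lf /locintN; exact: locintD. Qed.

Lemma locint_le f g : measurable_fun [set: R] f -> locint g ->
  (forall x, `|f x| <= g x) -> locint f.
Proof.
move=> mf [mg intg] fg; split => // a b.
apply: (le_integrable _ _ _ (intg a b)) => //.
- by apply/measurable_EFinP; exact: measurable_funTS.
- by move=> x _ /=; rewrite lee_fin (le_trans (fg x)) ?ler_norm.
Qed.

Lemma locint_norm f : locint f -> locint (fun x => `|f x|).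
Proof.
move=> [mf intf]; split; first exact: measurableT_comp.
by move=> a b; exact: integrable_norm.
Qed.

Lemma locint_continuous f : continuous f -> locint f.
Proof.
move=> cf; split; first exact: continuous_measurable_fun.
move=> a b; apply: (@integrableS _ _ _ mu `[a, b]%classic) => //.
  by apply: subset_itvr; rewrite bnd_simp.
apply: continuous_compact_integrable; first exact: segment_compact.
exact: continuous_subspaceT.
Qed.

Lemma locint_cst k : locint (fun=> k).
Proof. by apply: locint_continuous => x; exact: cst_continuous. Qed.

Lemma locint_bndM f g M : measurable_fun [set: R] f -> locint g ->
  (forall x, `|f x| <= M) -> locint (fun x => f x * g x).
Proof.
move=> mf lg fM; apply: (locint_le _ (locintZ M (locint_norm lg))).
  by apply: measurable_funM => //; exact: locint_mfun.
by move=> x; rewrite normrM ler_wpM2r.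
Qed.

Lemma locint_sqr f : measurable_fun [set: R] f ->
  locint (fun x => f x ^+ 2) -> locint f.
Proof.
move=> mf lf2; apply: (locint_le mf (locintD (locint_cst 1) lf2)) => x.
have := sqr_ge0 (`|f x| - 1); rewrite sqrrB1 -normrX ger0_norm ?sqr_ge0//.
have := normr_ge0 (f x); lra.
Qed.

Lemma locint_restrict f a b : mu.-integrable `]a, b[ (EFin \o f) ->
  locint (f \_ `]a, b[).
Proof.
move=> intf; have H : mu.-integrable setT (EFin \o (f \_ `]a, b[)).
  by rewrite -restrict_EFin -integrable_mkcond.
split; first by apply/measurable_EFinP; exact: measurable_int H.
by move=> c d; apply: integrableS H.
Qed.

Lemma itg_add f x y z : locint f -> x <= y -> y <= z ->
  itg f x z = itg f x y + itg f y z.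
Proof.
move=> lf xy yz; rewrite /itg -(@Rintegral_itvB _ f (BRight x) (BRight z) y).
- by rewrite addrC subrK.
- exact: locint_itv.
- by rewrite bnd_simp.
- by rewrite bnd_simp.
Qed.

Lemma itgxx f x : itg f x x = 0.
Proof. by rewrite /itg set_itv_ge ?Rintegral_set0// bnd_simp ltxx. Qed.

Lemma itgD f g x y : locint f -> locint g ->
  itg (fun t => f t + g t) x y = itg f x y + itg g x y.
Proof. by move=> lf lg; rewrite /itg RintegralD//; exact: locint_itv. Qed.

Lemma itgB f g x y : locint f -> locint g ->
  itg (fun t => f t - g t) x y = itg f x y - itg g x y.
Proof. by move=> lf lg; rewrite /itg RintegralB//; exact: locint_itv. Qed.

Lemma itgZ k f x y : locint f -> itg (fun t => k * f t) x y = k * itg f x y.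
Proof. by move=> lf; rewrite /itg RintegralZl//; exact: locint_itv. Qed.

Lemma itg_cst k x y : x <= y -> itg (fun=> k) x y = k * (y - x).
Proof.
move=> xy; rewrite /itg Rintegral_cst//=.
rewrite lebesgue_measure_itv/= lte_fin.
by move: xy; rewrite le_eqVlt => /predU1P[->|->//]; rewrite ltxx subrr.
Qed.

Lemma eq_itg f g x y : (forall t, x < t -> t <= y -> f t = g t) ->
  itg f x y = itg g x y.
Proof.
move=> fg; apply: eq_Rintegral => t; rewrite inE/= in_itv/= => /andP[xt ty].
exact: fg.
Qed.

Lemma itg_ge0 f x y : (forall t, 0 <= f t) -> 0 <= itg f x y.
Proof. by move=> f0; apply: Rintegral_ge0. Qed.

Lemma itg_le f g x y : locint f -> locint g ->
  (forall t, x < t -> t <= y -> f t <= g t) -> itg f x y <= itg g x y.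
Proof.
move=> lf lg fg; apply: le_Rintegral => //; [exact: locint_itv..|].
by move=> t /=; rewrite in_itv/= => /andP[xt ty]; exact: fg.
Qed.

Lemma itg_norm f x y : locint f -> `|itg f x y| <= itg (fun t => `|f t|) x y.
Proof. by move=> lf; apply: le_normr_Rintegral => //; exact: locint_itv. Qed.

Lemma itg_cauchy_schwarz f x y : measurable_fun [set: R] f ->
  locint (fun t => f t ^+ 2) -> x <= y ->
  itg f x y ^+ 2 <= (y - x) * itg (fun t => f t ^+ 2) x y.
Proof.
move=> mf lf2; have lf := locint_sqr mf lf2.
rewrite le_eqVlt => /predU1P[->|xy].
  by rewrite !itgxx mulr0 expr0n.
(* With [m] the mean value, the inequality is the nonnegativity of the integral of (f - m)^2. *)
pose m := itg f x y / (y - x).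
have : 0 <= itg (fun t => (f t ^+ 2 - (2 * m) * f t) + m ^+ 2) x y.
  apply: itg_ge0 => t.
  by have := sqr_ge0 (f t - m); rewrite sqrrB -mulr_natl; lra.
rewrite itgD; [|exact/locintB/locintZ|exact: locint_cst].
rewrite itgB//; last exact: locintZ.
rewrite itgZ// (itg_cst _ (ltW xy)).
have -> : itg f x y = m * (y - x) by rewrite /m divfK// gt_eqF// subr_gt0.
have d0 : 0 < y - x by rewrite subr_gt0.
move=> H; have := mulr_ge0 (ltW d0) H; lra.
Qed.

(* Telescoping over a fine subdivision bounds |U b - U a| by e * (V b - V a). *)
Lemma sewing (U V : R -> R) a b : a <= b ->
  (forall e : R, 0 < e -> exists2 d : R, 0 < d & forall x y, a <= x -> x <= y -> y <= b ->
     y - x < d -> `|U y - U x| <= e * (V y - V x)) ->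
  U b = U a.
Proof.
rewrite le_eqVlt => /predU1P[->//|ab] H.
suff K (e : R) : 0 < e -> `|U b - U a| <= e * (V b - V a).
  apply/eqP; rewrite -subr_eq0 -normr_le0; apply/ler_addgt0Pr => e e0.
  rewrite add0r.
  pose c := e / (1 + `|V b - V a|).
  have p0 : 0 < 1 + `|V b - V a| by rewrite ltr_pwDl.
  have c0 : 0 < c by rewrite divr_gt0.
  apply: (le_trans (K _ c0)); apply: (le_trans (ler_norm _)).
  rewrite normrM (gtr0_norm c0) /c mulrAC ler_pdivrMr// ler_pM2l//.
  lra.
move=> e0; have [d d0 Hd] := H _ e0.
pose n := (Num.trunc ((b - a) / d)).+1.
have ndp : (b - a) < d * n%:R.
  by rewrite mulrC -ltr_pdivrMr// truncnS_gt.
have n0 : (0 : R) < n%:R by rewrite ltr0n.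
pose h := (b - a) / n%:R.
have h0 : 0 < h by rewrite divr_gt0// subr_gt0.
have hd : h < d by rewrite /h ltr_pdivrMr.
pose X (i : nat) := a + h * i%:R.
have X0 : X 0%N = a by rewrite /X mulr0 addr0.
have Xn : X n = b by rewrite /X /h divfK ?gt_eqF// addrC subrK.
have XS i : X i.+1 - X i = h by rewrite /X -natr1 mulrDr; ring.
have -> : U b - U a = \sum_(0 <= i < n) (U (X i.+1) - U (X i)).
  by rewrite telescope_sumr// X0 Xn.
have -> : V b - V a = \sum_(0 <= i < n) (V (X i.+1) - V (X i)).
  by rewrite telescope_sumr// X0 Xn.
apply: (le_trans (ler_norm_sum _ _ _)); rewrite mulr_sumr.
rewrite [leLHS]big_nat_cond [leRHS]big_nat_cond.
apply: ler_sum => i /andP[/andP[_ iltn] _]; apply: Hd.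
- by rewrite /X lerDl mulr_ge0// ltW.
- by rewrite -subr_ge0 XS ltW.
- by rewrite -Xn /X lerD2l ler_wpM2l ?ler_nat// ltW.
- by rewrite XS.
Qed.

End Integral.

Section ChainRule.
Context {R : realType}.
Local Notation mu := (@lebesgue_measure R).
Implicit Types (f g p q : R -> R) (x y z a b c : R).

Definition ucont p :=
  forall e : R, 0 < e ->
    exists2 d : R, 0 < d & forall x y, `|y - x| < d -> `|p y - p x| <= e.

Lemma ucont_continuous p : ucont p -> continuous p.
Proof.
move=> up x; apply/cvgrPdist_le => e e0; have [d d0 H] := up _ e0.
near=> y; apply: H; near: y; exact: (@cvgr_dist_lt _ _ _ (nbhs x) _ id x).
Unshelve. all: by end_near. Qed.

Lemma lipschitz_ucont p L : (forall x y, `|p y - p x| <= L * `|y - x|) -> ucont p.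
Proof.
move=> lipp e e0; have k0 : 0 < `|L| + 1 by rewrite ltr_wpDl.
exists (e / (`|L| + 1)); first by rewrite divr_gt0.
move=> x y; rewrite ltr_pdivlMr// => xy; apply: (le_trans (lipp x y)).
apply: le_trans (ltW xy); rewrite mulrC ler_wpM2l//.
by rewrite (le_trans (ler_norm _))// lerDl.
Qed.

(** The order of the quantifiers is the point: [d] depends on [K] and [e] only, so one modulus
    serves a whole sequence of functions and its limit. *)
Lemma hoelder_modulus (K e : R) : 0 < e -> exists2 d : R, 0 < d &
  forall p, (forall x y, (p y - p x) ^+ 2 <= K * `|y - x|) ->
    forall x y, `|y - x| < d -> `|p y - p x| <= e.
Proof.
move=> e0; have k0 : 0 < `|K| + 1 by rewrite ltr_wpDl.
exists (e ^+ 2 / (`|K| + 1)); first by rewrite divr_gt0// exprn_gt0.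
move=> p hp x y; rewrite ltr_pdivlMr// => xy.
rewrite -ler_sqr ?nnegrE ?(ltW e0)// real_normK ?num_real//.
apply: (le_trans (hp x y)); apply: le_trans (ltW xy).
rewrite mulrC ler_wpM2l//.
by rewrite (le_trans (ler_norm _))// lerDl.
Qed.

Lemma hoelder_ucont p K :
  (forall x y, (p y - p x) ^+ 2 <= K * `|y - x|) -> ucont p.
Proof.
by move=> hp e /(hoelder_modulus K)[d d0 H]; exists d => // x y; exact: H.
Qed.

Lemma ucontD f g : ucont f -> ucont g -> ucont (fun x => f x + g x).
Proof.
move=> uf ug e e0; have e20 : 0 < e / 2 by rewrite divr_gt0.
have [d d0 Hf] := uf _ e20; have [d' d'0 Hg] := ug _ e20.
exists (Num.min d d'); first by rewrite lt_min d0.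
move=> x y; rewrite lt_min => /andP[/Hf hf /Hg hg].
rewrite opprD addrACA [leRHS]splitr.
by rewrite (le_trans (ler_normD _ _))// lerD.
Qed.

Lemma locint_continuousM f g : continuous f -> locint g ->
  locint (fun x => f x * g x).
Proof.
move=> cf lg; have mf : measurable_fun [set: R] f by exact: continuous_measurable_fun.
have mg := locint_mfun lg.
split; first exact: measurable_funM.
move=> a b.
have /compact_bounded[M [_ HM]] : compact (f @` `[a, b]).
  apply: continuous_compact; last exact: segment_compact.
  exact: continuous_subspaceT.
have M1 : M < `|M| + 1 by rewrite (le_lt_trans (ler_norm _))// ltrDl.
apply: (le_integrable _ _ _ (locint_itv a b (locintZ (`|M| + 1) (locint_norm lg)))) => //.
- by apply/measurable_EFinP; apply: measurable_funTS; exact: measurable_funM.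
- move=> x /=; rewrite in_itv/= => /andP[ax xb].
  rewrite lee_fin normrM [leRHS]ger0_norm ?mulr_ge0 ?addr_ge0//.
  rewrite ler_wpM2r//; apply: (HM _ M1).
  by exists x => //=; rewrite in_itv/= (ltW ax).
Qed.

(** This is absolute continuity in integral form; nothing is asserted about pointwise derivatives of
    [p]. *)
Definition prim p q :=
  locint q /\ forall x y, x <= y -> p y - p x = itg q x y.

Lemma prim_norm p q x y : prim p q -> x <= y ->
  `|p y - p x| <= itg (fun t => `|q t|) x y.
Proof. by move=> [lq pq] xy; rewrite pq//; exact: itg_norm. Qed.

(** Cauchy-Schwarz gives the one-dimensional Morrey embedding, with exponent 1/2. The squared form
    avoids roots and is closed under pointwise limits. *)
Lemma prim_hoelder p q K : prim p q -> locint (fun t => q t ^+ 2) ->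
  (forall x y, itg (fun t => q t ^+ 2) x y <= K) ->
  forall x y, (p y - p x) ^+ 2 <= K * `|y - x|.
Proof.
move=> [lq pq] lq2 qK x y; wlog xy : x y / x <= y.
  move=> H; case: (leP x y) => [/H//|/ltW/H].
  by rewrite -sqrrN opprB distrC.
rewrite pq// mulrC ger0_norm ?subr_ge0//.
apply: (le_trans (itg_cauchy_schwarz _ _ _)) => //; first exact: locint_mfun.
by rewrite ler_wpM2l// subr_ge0.
Qed.

Lemma prim_lip p q M : prim p q -> (forall x, `|q x| <= M) ->
  forall x y, `|p y - p x| <= M * `|y - x|.
Proof.
move=> pq qM x y; wlog xy : x y / x <= y.
  move=> H; case: (leP x y) => [/H//|/ltW/H].
  by rewrite distrC [`|x - y|]distrC.
apply: (le_trans (prim_norm pq xy)).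
rewrite [`|y - x|]ger0_norm ?subr_ge0// -(itg_cst _ xy).
by apply: itg_le => [||t _ _//]; [exact/locint_norm/(proj1 pq)|exact: locint_cst].
Qed.

(** As [q] is merely integrable, nothing can be differentiated pointwise. On a short interval [p]
    oscillates by at most eta, so the Taylor remainder and the error of freezing [dphi] at the left
    end are each at most L * eta times the integral of |q|. Errors of this additive kind are what
    [sewing] sums. *)
Lemma chain_rule (phi dphi : R -> R) p q L : prim p q -> ucont p ->
  locint (fun t => dphi (p t) * q t) -> 0 <= L ->
  (forall x y, `|phi (p y) - phi (p x) - dphi (p x) * (p y - p x)|
     <= L * `|p y - p x| ^+ 2) ->
  (forall x y, `|dphi (p y) - dphi (p x)| <= L * `|p y - p x|) ->
  prim (phi \o p) (fun t => dphi (p t) * q t).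
Proof.
move=> pq up lpq L0 Taylor Lip; split => // a b ab.
have [lq pqE] := pq.
pose U t := phi (p t) - itg (fun t => dphi (p t) * q t) a t.
pose V t := itg (fun t => `|q t|) a t.
have lnq := locint_norm lq.
suff : U b = U a.
  by rewrite /U itgxx subr0 => /eqP; rewrite subr_eq => /eqP /= ->; rewrite addrAC subrr add0r.
apply: (@sewing _ _ V) => // e e0.
(* Two errors of size L * eta have to fit into [e]; the added 1 keeps the quotient meaningful when L
   = 0. *)
have K0 : 0 < 2 * L + 1 by rewrite ltr_wpDl// mulr_ge0.
have [d d0 Hd] := up _ (divr_gt0 e0 K0).
set eta := e / _ in Hd.
have eta0 : 0 < eta by rewrite divr_gt0.
exists d => // x y ax xy yb yxd.
have Vxy : V y - V x = itg (fun t => `|q t|) x y.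
  by rewrite /V (itg_add lnq ax xy) addrAC subrr add0r.
have Uxy : U y - U x = (phi (p y) - phi (p x) - dphi (p x) * (p y - p x)) +
    itg (fun t => dphi (p x) * q t - dphi (p t) * q t) x y.
  rewrite /U (itg_add lpq ax xy) itgB//; last exact: locintZ.
  by rewrite itgZ// -pqE//; ring.
have osc t : x <= t -> t <= y -> `|p t - p x| <= eta.
  move=> xt ty; apply: Hd; rewrite ger0_norm ?subr_ge0//.
  by apply: le_lt_trans yxd; rewrite lerD2r.
have h1 : `|phi (p y) - phi (p x) - dphi (p x) * (p y - p x)| <= L * eta * (V y - V x).
  apply: (le_trans (Taylor x y)); rewrite -mulrA ler_wpM2l// expr2.
  by rewrite ler_pM// ?osc// Vxy (prim_norm pq).
have h2 : `|itg (fun t => dphi (p x) * q t - dphi (p t) * q t) x y| <= L * eta * (V y - V x).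
  apply: le_trans (itg_norm _ _ _) _; first by apply: locintB => //; exact: locintZ.
  rewrite Vxy -itgZ//; apply: itg_le => [||t xt ty].
  - by apply/locint_norm/locintB => //; exact: locintZ.
  - exact: locintZ.
  - rewrite -mulrBl normrM ler_wpM2r// distrC.
    by rewrite (le_trans (Lip _ _))// ler_wpM2l// osc// ltW.
rewrite Uxy; apply: (le_trans (ler_normD _ _)); apply: (le_trans (lerD h1 h2)).
rewrite -mulrDl ler_wpM2r//; first by rewrite Vxy itg_ge0.
rewrite /eta; set k := 2 * L + 1 in K0 *.
rewrite -mulr2n -mulr_natl mulrA mulrCA -[leRHS]mulr1 ler_pM2l//.
by rewrite ler_pdivrMr// mul1r /k lerDl.
Qed.

Lemma prim_sqr p q : prim p q -> ucont p -> prim (fun x => p x ^+ 2) (fun t => 2 * p t * q t).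
Proof.
move=> pq up; have cp := ucont_continuous up.
apply: (@chain_rule (fun s => s ^+ 2) (fun s => 2 * s) p q 2) => //.
- apply: locint_continuousM; last exact: (proj1 pq).
  by move=> x; apply: cvgM; [exact: cvg_cst|exact: cp].
- move=> x y; rewrite [X in `|X|](_ : _ = (p y - p x) ^+ 2); last by ring.
  rewrite normrX ler_peMl// ?ler1n// exprn_ge0//.
- by move=> x y; rewrite -mulrBr normrM ger0_norm.
Qed.

Lemma primD p q f g : prim p q -> prim f g ->
  prim (fun x => p x + f x) (fun x => q x + g x).
Proof.
move=> [lq pq] [lg fg]; split; first exact: locintD.
by move=> x y xy; rewrite itgD// -pq// -fg//; ring.
Qed.

Lemma primZ k p q : prim p q -> prim (fun x => k * p x) (fun x => k * q x).
Proof.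
move=> [lq pq]; split; first exact: locintZ.
by move=> x y xy; rewrite itgZ// -pq// mulrBr.
Qed.

(* By polarization, fh is a combination of the squares of f + h, f and h. *)
Lemma product_rule f g h k : prim f g -> prim h k -> ucont f -> ucont h ->
  prim (fun x => f x * h x) (fun t => f t * k t + h t * g t).
Proof.
move=> fg hk uf uh.
have := primZ 2^-1 (primD (prim_sqr (primD fg hk) (ucontD uf uh))
  (primZ (-1) (primD (prim_sqr fg uf) (prim_sqr hk uh)))).
by congr prim; apply/funext => x; field.
Qed.

End ChainRule.

(** * Weak derivatives *)

Section WeakDerivative.
Context {R : realType}.
Local Notation mu := (@lebesgue_measure R).
Implicit Types (f g h p q u phi : R -> R) (x y z a b c t : R).

Lemma in_oitv x : (x \in oitv) = (-1 < x < 1).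
Proof. by apply/idP/idP; rewrite inE /oitv/= in_itv. Qed.

Lemma in_citv x : (x \in citv) = (-1 <= x <= 1).
Proof. by apply/idP/idP; rewrite inE /citv/= in_itv. Qed.

Lemma ae_itv_ex (P : R -> Prop) a b : a < b -> {ae mu, forall x, P x} ->
  exists x, [/\ a < x, x < b & P x].
Proof.
move=> ab aeP; apply: contrapT => nP.
have : mu `]a, b[%classic = 0%E.
  apply/negligibleP => //; have [N [mN N0 sub]] := aeP.
  exists N; split => // x /= xab; apply: sub => /= Px.
  by apply: nP; exists x; move: xab; rewrite in_itv/= => /andP[].
rewrite lebesgue_measure_itv/= lte_fin ab -EFinD => /eqP.
by rewrite eqe subr_eq0 gt_eqF.
Qed.

Lemma eq_within_ae f g :
  {within citv, continuous f} -> {within citv, continuous g} ->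
  {ae mu, forall x, x \in oitv -> f x = g x} -> {in citv, f =1 g}.
Proof.
move=> cf cg fg x xI.
have xI' : citv x by move: xI; rewrite inE.
apply/eqP; rewrite -subr_eq0 -normr_le0; apply/ler_addgt0Pr => e e0; rewrite add0r.
have e20 : 0 < e / 2 by rewrite divr_gt0.
have H (k : R -> R) : {within citv, continuous k} ->
    exists2 d : R, 0 < d & forall y, citv y -> `|x - y| < d -> `|k x - k y| < e / 2.
  move=> ck; have /cvgrPdist_lt/(_ _ e20) := (subspace_continuousP _ _).1 ck x xI'.
  rewrite near_withinE => /nbhs_ballP[d d0 Hd].
  by exists d => // y yI xy; apply: (Hd y).
have [d d0 Hf] := H f cf; have [d' d'0 Hg] := H g cg.
pose m := Num.min d d'; have m0 : 0 < m by rewrite lt_min d0.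
have [x1 x2] : -1 <= x /\ x <= 1 by move: xI; rewrite in_citv => /andP[].
(* The window around [x] is cut down to (-1, 1), where the two functions agree almost everywhere. It
   is nonempty even when [x] is an endpoint, which is how equality reaches the boundary. *)
have lt12 : Num.max (-1) (x - m) < Num.min 1 (x + m).
  by rewrite gt_max !lt_min; apply/andP; split; apply/andP; split; lra.
have [y [y1 y2 Py]] := ae_itv_ex lt12 fg.
move: y1 y2; rewrite gt_max lt_min => /andP[y1 xmy] /andP[y2 yxm].
have yo : y \in oitv by rewrite in_oitv y1.
have yc : citv y by rewrite /citv/= in_itv/= !ltW.
have xym : `|x - y| < m by rewrite ltr_norml; apply/andP; split; lra.
move: xym; rewrite lt_min => /andP[/(Hf _ yc) fxy /(Hg _ yc)]; rewrite -(Py yo) => gxy.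
rewrite (_ : f x - g x = (f x - f y) - (g x - f y)); last by ring.
apply: (le_trans (ler_normB _ _)); rewrite [leRHS]splitr.
by rewrite lerD// ltW.
Qed.

Lemma itg_oitv f : locint f -> \int[mu]_(t in oitv) f t = itg f (-1) 1.
Proof.
move=> lf; rewrite /itg/oitv Rintegral_itv_bndo_bndc//.
by apply: integrableS (locint_itv (-1) 1 lf) => //; apply: subset_itvl; rewrite bnd_simp.
Qed.

Lemma L2P f : L2 f <-> measurable_fun [set: R] (f \_ oitv) /\
  mu.-integrable [set: R] (EFin \o (fun x => (f \_ oitv) x ^+ 2)).
Proof.
split=> [H|[mf intf]].
  split; last exact: Lfun2_integrable_sqr.
  by move: H; rewrite /L2 inE => /andP[]; rewrite inE.
rewrite /L2 inE; apply/andP; rewrite !inE/=; split => //.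
rewrite /finite_norm unlock; apply: poweR_lty.
rewrite (@eq_integral _ _ _ mu _ (fun x => `|((f \_ oitv) x ^+ 2)%:E|)%E).
  by move/integrableP : intf => [].
move=> x _ /=; by rewrite powR_mulrn// normrX.
Qed.

Lemma L2_locint f : L2 f -> locint (f \_ oitv) /\ locint (fun x => (f \_ oitv) x ^+ 2).
Proof.
move=> /L2P[mf intf].
have l2 : locint (fun x => (f \_ oitv) x ^+ 2).
  split; first exact: measurable_funX.
  by move=> a b; apply: integrableS intf.
by split => //; exact: locint_sqr.
Qed.

Lemma locint_supp_bound h : locint h -> (forall x, x \notin oitv -> h x = 0) ->
  (forall x, 0 <= h x) -> forall x y, itg h x y <= itg h (-1) 1.
Proof.
move=> lh h0 hge0 x y.
have [yx|/ltW xy] := leP y x.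
  rewrite /itg [X in Rintegral _ X _]set_itv_ge ?bnd_simp -?leNgt// Rintegral_set0.
  exact: itg_ge0.
pose a := Num.min x (-1); pose b := Num.max y 1.
have ax : a <= x by rewrite ge_min lexx.
have yb : y <= b by rewrite le_max lexx.
have a1 : a <= -1 by rewrite ge_min lexx orbT.
have b1 : 1 <= b by rewrite le_max lexx orbT.
have z s t : (t <= -1) || (1 <= s) -> itg h s t = 0.
  move=> st; rewrite (@eq_itg _ _ (fun=> 0)) ?/itg ?/Rintegral ?integral0// => r sr rt.
  apply: h0; apply/negP; rewrite in_oitv => /andP[r1 r2].
  by case/orP: st => ?; [have := lt_le_trans r1 rt|have := lt_trans sr r2];
    rewrite ltNge => /negP; apply => //; exact: ltW.
apply: (@le_trans _ _ (itg h a b)).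
  rewrite (itg_add lh ax (le_trans xy yb)) (itg_add lh xy yb).
  have := itg_ge0 a x hge0; have := itg_ge0 y b hge0; lra.
rewrite (itg_add lh a1 (le_trans _ b1)); last by lra.
rewrite (itg_add lh _ b1); last by lra.
by rewrite (z a) ?lexx// (z 1) ?lexx ?orbT// add0r addr0.
Qed.

Lemma is_derive_of_quadratic f x l C :
  (forall k, `|f (x + k) - f x - l * k| <= C * k ^+ 2) -> is_derive x 1 f l.
Proof.
move=> H.
have lim : (fun k : R => k^-1 *: ((f \o shift x) (k *: (1:R^o)) - f x)) @ 0^' --> l.
  apply/cvgrPdist_le => e e0.
  have C0 : 0 < `|C| + 1 by rewrite ltr_wpDl.
  near=> k.
  have k0 : k != 0 by near: k; exact: nbhs_dnbhs_neq.
  have ke : `|k| < e / (`|C| + 1).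
    near: k; apply: dnbhs0_lt; rewrite divr_gt0//.
  have kn0 : 0 < `|k| by rewrite normr_gt0.
  rewrite /= [k%:A]mulr1.
  rewrite (_ : _ - _ = - (k^-1 * (f (x + k) - f x - l * k))); last first.
    by rewrite [k + x]addrC /GRing.scale/=; field.
  rewrite normrN normrM normfV ler_pdivrMl//.
  apply: (le_trans (H k)); rewrite -real_normK ?num_real// expr2 mulrCA ler_wpM2l//.
  rewrite ltr_pdivlMr// in ke; apply: le_trans (ltW ke); rewrite mulrC ler_wpM2l//.
  by rewrite (le_trans (ler_norm _))// lerDl.
split; first by apply/cvg_ex; exists l.
exact/cvg_lim.
Unshelve. all: by end_near. Qed.

End WeakDerivative.

(** * The fundamental lemma of the calculus of variations *)

Section FundamentalLemma.
Context {R : realType}.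
Local Notation mu := (@lebesgue_measure R).
Implicit Types (f g h p q u phi : R -> R) (x y z a b c t e : R).

Lemma prim_of_derive f g : (forall x, is_derive x 1 f (g x)) -> continuous g ->
  prim f g.
Proof.
move=> fg cg; have lg := locint_continuous cg.
split => // x y; rewrite le_eqVlt => /predU1P[->|xy]; first by rewrite itgxx subrr.
have cf : continuous f.
  by move=> z; apply/differentiable_continuous/derivable1_diffP; case: (fg z).
have := @continuous_FTC2 R g f x y xy (continuous_subspaceT cg).
move=> /(_ _ _) H; apply/esym; rewrite /itg Rintegral_itv_obnd_cbnd; last exact: locint_itv.
rewrite /Rintegral H//.
- split; [by move=> z _; case: (fg z)| |].
    exact: (cvg_at_right_filter (cf x)).
  exact: (cvg_at_left_filter (cf y)).
- by move=> z _; rewrite derive1E; case: (fg z).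
Qed.

Lemma test_function_prim phi : test_function phi ->
  [/\ prim phi (derive1 phi), ucont phi, continuous (derive1 phi) &
      forall x, x \notin oitv -> phi x = 0].
Proof.
move=> [dphi cphi [a [b [a1 b1 ab0]]]].
have pphi : prim phi (derive1 phi).
  apply: prim_of_derive => // x; split; first exact: dphi.
  by rewrite derive1E.
split => //; last first.
  move=> x xo; apply: ab0; apply: contra xo; rewrite in_itv/= => /andP[ax xb].
  by rewrite in_oitv (lt_le_trans a1)//= (le_lt_trans xb).
have d0 x : x \notin `[a, b] -> derive1 phi x = 0.
  move=> xab; rewrite derive1E.
  rewrite (@near_eq_derive _ _ _ phi (cst 0)); first exact: derive_cst.
  have : open (~` `[a, b]%classic) by apply: closed_openC; exact: itv_closed.
  rewrite openE => /(_ x) []; first by move=> /=; apply/negP.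
  move=> e e0 He; exists e => // y /He /= yab; apply: ab0; exact/negP.
have /compact_bounded[M [_ HM]] : compact (derive1 phi @` `[a, b]).
  apply: continuous_compact; last exact: segment_compact.
  exact: continuous_subspaceT.
have M1 : M < `|M| + 1 by rewrite (le_lt_trans (ler_norm _))// ltrDl.
apply: (lipschitz_ucont (prim_lip pphi (M := `|M| + 1) _)) => x.
have [xab|xab] := boolP (x \in `[a, b]).
  by apply: (HM _ M1); exists x.
by rewrite d0// normr0 addr_ge0.
Qed.

Lemma prim_weak_derivative f g : prim f g -> ucont f -> is_weak_derivative f g.
Proof.
move=> fg uf phi /test_function_prim[pphi uphi cphi phi0].
have [lg _] := fg.
have l1 : locint (fun t => f t * derive1 phi t).
  by apply: locint_continuousM; [exact: ucont_continuous|exact: (proj1 pphi)].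
have l2 : locint (fun t => phi t * g t).
  by apply: locint_continuousM => //; exact: ucont_continuous.
have [_ /(_ (-1) 1)] := product_rule fg pphi uf uphi.
rewrite !phi0 ?in_oitv ?ltxx ?andbF// !mulr0 subrr itgD// => H.
have {}H : 0 = itg (fun t => f t * derive1 phi t) (-1) 1 + itg (fun t => phi t * g t) (-1) 1.
  by apply: H; lra.
rewrite itg_oitv//.
have -> : (fun t => g t * phi t) = (fun t => phi t * g t).
  by apply/funext => t; rewrite mulrC.
rewrite itg_oitv//; lra.
Qed.

Lemma lebesgue_pt_itg u a : locint u -> lebesgue_pt u a ->
  forall eta : R, 0 < eta -> exists2 d : R, 0 < d & forall e, 0 < e -> e < d ->
    itg (fun t => `|u t - u a|) (a - e) (a + e) <= eta * e.
Proof.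
move=> lu /fine_cvgP[_ /cvgrPdist_lt H] eta eta0.
(* The average runs over a ball of measure 2 e, hence the half. *)
have eta20 : 0 < eta / 2 by rewrite divr_gt0.
have /(_ _ eta20) := H.
rewrite near_withinE => /nbhs_ballP[d d0 Hd].
exists d => // e e0 ed.
have := Hd e; rewrite /ball/= sub0r normrN gtr0_norm// => /(_ ed e0).
rewrite /davg /iavg sub0r normrN.
have lua : locint (fun t => `|u t - u a|).
  by apply/locint_norm/locintB => //; exact: locint_cst.
have -> : (\int[mu]_(y in ball a e) `|((center (u a) \o u) y)%:E|)%E =
    (itg (fun t => `|u t - u a|) (a - e) (a + e))%:E.
  rewrite /itg -Rintegral_itv_bndo_bndc; last first.
    apply: integrableS (locint_itv (a - e) (a + e) lua) => //.
    by apply: subset_itvl; rewrite bnd_simp.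
  rewrite ball_itv /Rintegral fineK//.
  apply: integrable_fin_num => //.
  apply: integrableS (locint_itv (a - e) (a + e) lua) => //.
  by apply: subset_itvl; rewrite bnd_simp.
have -> : mu (ball a e) = (e *+ 2)%:E by apply: lebesgue_measure_ball; exact: ltW.
rewrite inver gt_eqF ?mulrn_wgt0//= -?EFinM/=.
rewrite ger0_norm; last by rewrite mulr_ge0 ?invr_ge0 ?mulrn_wge0 ?(ltW e0) ?itg_ge0.
rewrite ltr_pdivrMl ?mulrn_wgt0// => /ltW /le_trans; apply.
rewrite -mulr_natl; lra.
Qed.

(** [tent] is the hat function of mass 1 on [-1, 1], a second difference of the positive part;
    [step] is its C^1 antiderivative, climbing from 0 to 1. Test functions only have to be C^1, so
    these piecewise polynomials can play the part of smooth mollifiers. *)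
Let pos x := Num.max 0 x.
Let tent x := pos (x + 1) - 2 * pos x + pos (x - 1).
Let step x := 2^-1 * (pos (x + 1) ^+ 2 - 2 * pos x ^+ 2 + pos (x - 1) ^+ 2).

Lemma pos_taylor x k : `|pos (x + k) ^+ 2 - pos x ^+ 2 - 2 * pos x * k| <= k ^+ 2.
Proof.
rewrite ler_norml /pos; case: (lerP 0 (x + k)) => h1; case: (lerP 0 x) => h2;
  apply/andP; split; nra.
Qed.

Lemma pos_lip x y : `|pos y - pos x| <= `|y - x|.
Proof.
rewrite /pos; case: (lerP 0 x) => h1; case: (lerP 0 y) => h2 //.
- rewrite sub0r normrN ger0_norm// ltr0_norm; lra.
- rewrite subr0 ger0_norm// ger0_norm; lra.
- by rewrite subrr normr0.
Qed.

Lemma tent_continuous : continuous tent.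
Proof.
apply/ucont_continuous/(@lipschitz_ucont _ _ 4) => x y.
have h1 := pos_lip (x + 1) (y + 1); have h2 := pos_lip x y.
have h3 := pos_lip (x - 1) (y - 1).
rewrite (_ : y + 1 - (x + 1) = y - x) in h1; last by ring.
rewrite (_ : y - 1 - (x - 1) = y - x) in h3; last by ring.
rewrite /tent (_ : _ - _ = (pos (y + 1) - pos (x + 1)) - 2 * (pos y - pos x)
  + (pos (y - 1) - pos (x - 1))); last by ring.
apply: (le_trans (ler_normD _ _)).
have := ler_normB (pos (y + 1) - pos (x + 1)) (2 * (pos y - pos x)).
rewrite normrM ger0_norm//; lra.
Qed.

Lemma tent_ge0 x : 0 <= tent x.
Proof.
rewrite /tent /pos; case: (lerP 0 (x + 1)); case: (lerP 0 x); case: (lerP 0 (x - 1)); lra.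
Qed.

Lemma tent_le1 x : tent x <= 1.
Proof.
rewrite /tent /pos; case: (lerP 0 (x + 1)); case: (lerP 0 x); case: (lerP 0 (x - 1)); lra.
Qed.

Lemma tent0 x : (x <= -1) || (1 <= x) -> tent x = 0.
Proof.
rewrite /tent /pos => /orP[] ?;
case: (lerP 0 (x + 1)); case: (lerP 0 x); case: (lerP 0 (x - 1)); lra.
Qed.

Lemma step0 x : x <= -1 -> step x = 0.
Proof.
rewrite /step /pos => ?.
case: (lerP 0 (x + 1)); case: (lerP 0 x); case: (lerP 0 (x - 1)) => *; try lra.
all: try (rewrite (_ : x + 1 = 0); lra).
Qed.

Lemma step1 x : 1 <= x -> step x = 1.
Proof.
rewrite /step /pos => ?.
case: (lerP 0 (x + 1)); case: (lerP 0 x); case: (lerP 0 (x - 1)) => *; lra.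
Qed.

Let kernel a e t := e^-1 * tent ((t - a) / e).
Let ramp a e t := step ((t - a) / e).

Lemma kernel_continuous a e : continuous (kernel a e).
Proof.
move=> t; apply: cvgM; first exact: cvg_cst.
apply: (@continuous_comp _ _ _ (fun t => (t - a) / e) tent); last exact: tent_continuous.
by apply: cvgM; [apply: cvgB; [exact: cvg_id|exact: cvg_cst]|exact: cvg_cst].
Qed.

Lemma ramp_derive a e x : 0 < e -> is_derive x 1 (ramp a e) (kernel a e x).
Proof.
(* Each squared positive part has remainder at most k^2; the weights 1/2, 1, 1/2 in [step] add up to
   2, and rescaling divides by e^2. *)
move=> e0; apply: (@is_derive_of_quadratic _ _ _ _ (2 / e ^+ 2)) => k.
set s := (x - a) / e.
have st : `|step (s + k / e) - step s - tent s * (k / e)| <= 2 * (k / e) ^+ 2.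
  have h1 := pos_taylor (s + 1) (k / e); have h2 := pos_taylor s (k / e).
  have h3 := pos_taylor (s - 1) (k / e).
  rewrite /step /tent (addrAC s (k / e) 1) (addrAC s (k / e) (-1)).
  set A := pos _ ^+ 2 - _ - _ in h1; set B := pos _ ^+ 2 - _ - _ in h2.
  set C := pos _ ^+ 2 - _ - _ in h3.
  rewrite (_ : _ - _ - _ = 2^-1 * A - B + 2^-1 * C); last by rewrite /A /B /C; field; rewrite gt_eqF.
  apply: (le_trans (ler_normD _ _)).
  have := ler_normB (2^-1 * A) B.
  rewrite !normrM ger0_norm ?invr_ge0//; lra.
rewrite /ramp /kernel -/s (_ : (x + k - a) / e = s + k / e); last by rewrite /s; field; rewrite gt_eqF.
rewrite (_ : e^-1 * _ * k = tent s * (k / e)); last by field; rewrite gt_eqF.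
by apply: (le_trans st); rewrite expr_div_n mulrCA [leLHS]mulrC mulrAC.
Qed.

(** The kernel is a probability density supported in [a - e, a + e] and bounded by 1 / e. *)
Lemma kernel_average u a e : locint u -> 0 < e -> -1 <= a - e -> a + e <= 1 ->
  `|itg (fun t => kernel a e t * u t) (-1) 1 - u a|
    <= e^-1 * itg (fun t => `|u t - u a|) (a - e) (a + e).
Proof.
move=> lu e0 ae1 ae2.
have ck := @kernel_continuous a e.
have pk : prim (ramp a e) (kernel a e).
  by apply: prim_of_derive => // x; exact: ramp_derive.
have lk := proj1 pk.
have lku := locint_continuousM ck lu.
have k1 : itg (kernel a e) (-1) 1 = 1.
  have := (proj2 pk) (-1) 1 => <-; last by lra.
  rewrite /ramp step1 ?step0 ?subr0//; first by rewrite ler_pdivrMr//; lra.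
  by rewrite ler_pdivlMr//; lra.
have -> : itg (fun t => kernel a e t * u t) (-1) 1 - u a =
    itg (fun t => kernel a e t * (u t - u a)) (-1) 1.
  rewrite (@eq_itg _ (fun t => kernel a e t * (u t - u a))
    (fun t => kernel a e t * u t - u a * kernel a e t)); last by move=> *; ring.
  by rewrite itgB//; [rewrite itgZ// k1 mulr1|exact: locintZ].
have luc : locint (fun t => u t - u a) by apply: locintB => //; exact: locint_cst.
have lkuc := locint_continuousM ck luc.
have z s t : (t <= a - e) || (a + e <= s) ->
    itg (fun t => `|kernel a e t * (u t - u a)|) s t = 0.
  move=> st; rewrite (@eq_itg _ _ (fun=> 0)) ?/itg ?/Rintegral ?integral0// => r sr rt.
  rewrite /kernel tent0 ?mulr0 ?mul0r ?normr0//.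
  rewrite ler_pdivrMr// ler_pdivlMr//.
  by case/orP: st => ?; apply/orP; [left|right]; lra.
apply: (le_trans (itg_norm _ _ lkuc)).
have lkn := locint_norm lkuc.
rewrite (itg_add lkn ae1); last by lra.
rewrite (@itg_add _ _ (a - e) (a + e) 1)//; last by lra.
rewrite (z (-1)) ?lexx// (z (a + e)) ?lexx ?orbT// add0r addr0 -itgZ; last exact: locint_norm.
apply: itg_le => // [|t _ _]; first exact/locintZ/locint_norm.
rewrite normrM ler_wpM2r// /kernel normrM (ger0_norm (tent_ge0 _)) gtr0_norm ?invr_gt0//.
by rewrite ler_piMr ?tent_le1// invr_ge0 ltW.
Qed.

(** A single ramp never comes back to 0, but two ramps cancel once both have reached 1. The
    derivative of their difference compares averages around [a] and [b]. *)
Lemma ramp_test a b e : 0 < e -> -1 < a - e -> a + e < 1 -> -1 < b - e -> b + e < 1 ->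
  test_function (fun t => ramp a e t - ramp b e t) /\
  derive1 (fun t => ramp a e t - ramp b e t) = (fun t => kernel a e t - kernel b e t).
Proof.
move=> e0 a1 a2 b1 b2.
have D x : is_derive x 1 (fun t => ramp a e t - ramp b e t) (kernel a e x - kernel b e x).
  by apply: is_deriveB; exact: ramp_derive.
have E : derive1 (fun t => ramp a e t - ramp b e t) = (fun t => kernel a e t - kernel b e t).
  by apply/funext => x; rewrite derive1E; case: (D x).
split => //; split.
- by move=> x; case: (D x).
- by rewrite E => x; apply: cvgB; exact: kernel_continuous.
- exists (Num.min a b - e), (Num.max a b + e); split.
  + by rewrite ltrBrDr lt_min; apply/andP; split; lra.
  + by rewrite -ltrBrDr gt_max; apply/andP; split; lra.
  + move=> x; rewrite in_itv/= negb_and -!ltNge ltrBrDr lt_min => /orP[].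
    * move=> /andP[xa xb]; rewrite /ramp !step0 ?subrr// ler_pdivrMr//; lra.
    * rewrite -ltrBrDr gt_max => /andP[xa xb].
      by rewrite /ramp !step1 ?subrr// ler_pdivlMr//; lra.
Qed.

(** The lemma of du Bois-Reymond. Testing with a difference of ramps shows that the kernel averages
    of [u] around [a] and [b] coincide for every small width, and at Lebesgue points these averages
    tend to the values. *)
Lemma lebesgue_pt_eq u a b : locint u ->
  (forall phi, test_function phi -> itg (fun t => derive1 phi t * u t) (-1) 1 = 0) ->
  a \in oitv -> b \in oitv -> lebesgue_pt u a -> lebesgue_pt u b -> u a = u b.
Proof.
move=> lu H; rewrite !in_oitv => /andP[a1 a2] /andP[b1 b2] la lb.
apply/eqP; rewrite -subr_eq0 -normr_le0; apply/ler_addgt0Pr => eta eta0; rewrite add0r.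
have eta20 : 0 < eta / 2 by rewrite divr_gt0.
have [d d0 Ha] := lebesgue_pt_itg lu la eta20.
have [d' d'0 Hb] := lebesgue_pt_itg lu lb eta20.
(* A width below [m] keeps both kernels inside (-1, 1) and within the range of the two Lebesgue
   point estimates. *)
pose m := Num.min (Num.min d d') (Num.min (Num.min (1 + a) (1 - a)) (Num.min (1 + b) (1 - b))).
have m0 : 0 < m by rewrite !lt_min d0 d'0/= !subr_gt0 a2 b2 -!ltrBlDl !sub0r a1 b1.
pose e := m / 2; have e0 : 0 < e by rewrite divr_gt0.
have : e < m by rewrite /e ltr_pdivrMr// ltr_pMr// ltr1n.
rewrite /m !lt_min => /andP[/andP[ed ed'] /andP[/andP[ea ea'] /andP[eb eb']]].
have [tf E] := @ramp_test a b e e0 ltac:(lra) ltac:(lra) ltac:(lra) ltac:(lra).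
have := H _ tf; rewrite E.
have lka := locint_continuousM (@kernel_continuous a e) lu.
have lkb := locint_continuousM (@kernel_continuous b e) lu.
rewrite (@eq_itg _ _ (fun t => kernel a e t * u t - kernel b e t * u t)); last first.
  by move=> *; rewrite mulrBl.
rewrite itgB// => /eqP; rewrite subr_eq0 => /eqP kab.
have ha := @kernel_average u a e lu e0 ltac:(lra) ltac:(lra).
have hb := @kernel_average u b e lu e0 ltac:(lra) ltac:(lra).
have {}Ha := Ha _ e0 ed; have {}Hb := Hb _ e0 ed'.
have {}ha : `|itg (fun t => kernel a e t * u t) (-1) 1 - u a| <= eta / 2.
  by apply: (le_trans ha); rewrite ler_pdivrMl// mulrC.
have {}hb : `|itg (fun t => kernel b e t * u t) (-1) 1 - u b| <= eta / 2.
  by apply: (le_trans hb); rewrite ler_pdivrMl// mulrC.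
rewrite (_ : u a - u b = (itg (fun t => kernel b e t * u t) (-1) 1 - u b) -
   (itg (fun t => kernel a e t * u t) (-1) 1 - u a)); last by rewrite kab; ring.
by apply: (le_trans (ler_normB _ _)); rewrite [leRHS]splitr lerD.
Qed.

End FundamentalLemma.

(** * Uniqueness of weak derivatives and of continuous representatives *)

Section WeakUniqueness.
Context {R : realType}.
Local Notation mu := (@lebesgue_measure R).
Implicit Types (f g h p q u phi : R -> R) (x y z a b c t e : R).

Lemma aeS (P Q : R -> Prop) : (forall x, P x -> Q x) ->
  {ae mu, forall x, P x} -> {ae mu, forall x, Q x}.
Proof. by move=> PQ; apply: negligibleS => x /= nQ /PQ. Qed.

Lemma aeS2 (P Q S : R -> Prop) : (forall x, P x -> Q x -> S x) ->
  {ae mu, forall x, P x} -> {ae mu, forall x, Q x} -> {ae mu, forall x, S x}.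
Proof.
move=> PQS aP aQ; apply: (negligibleS _ (negligibleU aP aQ)) => x /= nS.
by apply: contrapT => /not_orP[/contrapT Px /contrapT /(PQS _ Px)].
Qed.

Lemma locint_locally_integrable u : locint u -> locally_integrable [set: R] u.
Proof.
move=> lu; split; [exact: locint_mfun|exact: openT|].
move=> K _ cK; have [M [_ HM]] := compact_bounded cK.
have M1 : M < `|M| + 1 by rewrite (le_lt_trans (ler_norm _))// ltrDl.
set N := `|M| + 1 in M1.
have sub : K `<=` `]- (N + 1), N].
  move=> x /(HM _ M1) /=; rewrite ler_norml in_itv/= => /andP[h1 h2]; rewrite h2 andbT.
  by apply: lt_le_trans h1; rewrite ltrN2 ltrDl.
have /integrableP[mu' lty] := locint_itv (- (N + 1)) N lu.
apply: le_lt_trans lty; apply: ge0_subset_integral => //.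
  exact: compact_measurable.
apply/measurable_EFinP/measurableT_comp => //; apply: measurable_funTS.
exact: locint_mfun.
Qed.

Lemma restrict_oitv f x : x \in oitv -> (f \_ oitv) x = f x.
Proof. by move=> xo; rewrite patchE xo. Qed.

Lemma restrict_oitv0 f x : x \notin oitv -> (f \_ oitv) x = 0.
Proof. by move=> xo; rewrite patchE (negbTE xo). Qed.

Lemma itg_itv0 q x y : (forall t, t \notin oitv -> q t = 0) -> (y <= -1) || (1 <= x) ->
  itg q x y = 0.
Proof.
move=> q0 xy; rewrite (@eq_itg _ _ (fun=> 0)) ?/itg ?/Rintegral ?integral0// => t xt ty.
by apply: q0; rewrite in_oitv; apply/negP => /andP[t1 t2]; case/orP: xy => ?; lra.
Qed.

Lemma prim_itg q : locint q -> (forall x, x \notin oitv -> q x = 0) ->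
  prim (fun x => itg q (-1) x) q.
Proof.
move=> lq q0; split => // x y xy.
have [x1|x1] := leP (-1) x; first by rewrite (itg_add lq x1 xy); ring.
rewrite (itg_itv0 (x := -1) (y := x))// ?(ltW x1)// subr0.
have [y1|y1] := leP (-1) y.
  by rewrite (@itg_add _ _ x (-1) y)// ?(ltW x1)// (itg_itv0 (x := x) (y := -1)) ?lexx ?add0r.
by rewrite !itg_itv0// ?(ltW y1).
Qed.

Lemma locint_sqr_ucont p q : prim p q -> locint (fun t => q t ^+ 2) ->
  (forall x, x \notin oitv -> q x = 0) -> ucont p.
Proof.
move=> pq lq2 q0; apply: hoelder_ucont.
apply: (prim_hoelder pq lq2 (K := itg (fun t => q t ^+ 2) (-1) 1)).
apply: locint_supp_bound => // x; last by rewrite sqr_ge0.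
by move=> /q0 ->; rewrite expr0n.
Qed.

Lemma itg_test f phi : test_function phi -> locint (f \_ oitv) ->
  \int[mu]_(x in oitv) (f x * derive1 phi x) =
     itg (fun t => derive1 phi t * (f \_ oitv) t) (-1) 1 /\
  \int[mu]_(x in oitv) (f x * phi x) = itg (fun t => phi t * (f \_ oitv) t) (-1) 1.
Proof.
move=> /test_function_prim[_ uphi cphi _] lf.
have cp := ucont_continuous uphi.
split.
  rewrite -itg_oitv; last exact: locint_continuousM.
  by apply: eq_Rintegral => x xo; rewrite restrict_oitv// mulrC.
rewrite -itg_oitv; last exact: locint_continuousM.
by apply: eq_Rintegral => x xo; rewrite restrict_oitv// mulrC.
Qed.

(** Subtracting from [f] the primitive of [g] leaves a function orthogonal to all derivatives of
    test functions, hence constant on its Lebesgue points in (-1, 1), which are almost all of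
    them. *)
Lemma weak_derivative_repr f g : L2 f -> L2 g -> is_weak_derivative f g ->
  exists c, {ae mu, forall x, x \in oitv -> f x = itg (g \_ oitv) (-1) x + c}.
Proof.
move=> /L2_locint[lf _] /L2_locint[lg lg2] wfg.
pose G x := itg (g \_ oitv) (-1) x.
have pG : prim G (g \_ oitv) by apply: prim_itg => //; exact: restrict_oitv0.
have uG : ucont G by apply: locint_sqr_ucont pG lg2 _; exact: restrict_oitv0.
have cG := ucont_continuous uG.
pose u x := (f \_ oitv) x - G x.
have lu : locint u by apply: locintB => //; exact: locint_continuous.
have tu phi : test_function phi -> itg (fun t => derive1 phi t * u t) (-1) 1 = 0.
  move=> tphi; have [pphi uphi cphi _] := test_function_prim tphi.
  rewrite (@eq_itg _ _ (fun t => derive1 phi t * (f \_ oitv) t - derive1 phi t * G t)); last first.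
    by move=> t _ _; rewrite mulrBr.
  rewrite itgB; [|exact: locint_continuousM|by apply: locint_continuousM => //; exact: locint_continuous].
  have := prim_weak_derivative pG uG tphi; have := wfg _ tphi.
  rewrite (itg_test tphi lf).1 (itg_test tphi lg).2 => ->.
  have E1 : \int[mu]_(x in oitv) (G x * derive1 phi x) = itg (fun t => derive1 phi t * G t) (-1) 1.
    rewrite -itg_oitv; last by apply: locint_continuousM => //; exact: locint_continuous.
    by apply: eq_Rintegral => x xo; rewrite mulrC.
  have E2 : \int[mu]_(x in oitv) ((g \_ oitv) x * phi x) = itg (fun t => phi t * (g \_ oitv) t) (-1) 1.
    rewrite -itg_oitv; last by apply: locint_continuousM => //; exact: ucont_continuous.
    by apply: eq_Rintegral => x xo; rewrite mulrC.
  by rewrite E1 E2 => ->; rewrite subrr.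
have leb := lebesgue_differentiation (locint_locally_integrable lu).
have [b [b1 b2 lb]] := ae_itv_ex (ltac:(lra) : (-1 : R) < 1) leb.
exists (u b); apply: (aeS _ leb) => x lx xo.
have bo : b \in oitv by rewrite in_oitv b1.
by rewrite -(lebesgue_pt_eq lu tu xo bo lx lb) /u restrict_oitv// addrC subrK.
Qed.

(** The difference integrates to 0 over every interval, hence vanishes at each of its Lebesgue
    points. *)
Lemma ae_eq_of_prim f g1 g2 : L2 g1 -> L2 g2 ->
  prim f (g1 \_ oitv) -> prim f (g2 \_ oitv) ->
  {ae mu, forall x, x \in oitv -> g1 x = g2 x}.
Proof.
move=> /L2_locint[l1 _] /L2_locint[l2 _] p1 p2.
pose u x := (g1 \_ oitv) x - (g2 \_ oitv) x.
have lu : locint u by exact: locintB.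
have u0 x y : x <= y -> itg u x y = 0.
  by move=> xy; rewrite itgB// -(proj2 p1)// -(proj2 p2)// subrr.
have leb := lebesgue_differentiation (locint_locally_integrable lu).
apply: (aeS _ leb) => x lx xo; apply/eqP; rewrite -subr_eq0.
rewrite -(restrict_oitv g1 xo) -(restrict_oitv g2 xo) -/(u x) -normr_le0.
apply/ler_addgt0Pr => eta eta0; rewrite add0r.
have [d d0 Hd] := lebesgue_pt_itg lu lx eta0.
have e0 : 0 < d / 2 by rewrite divr_gt0.
have ed : d / 2 < d by rewrite ltr_pdivrMr// ltr_pMr// ltr1n.
have := Hd _ e0 ed; set e := d / 2 in e0 ed *.
have luc : locint (fun t => u t - u x) by apply: locintB => //; exact: locint_cst.
move=> /(le_trans (itg_norm _ _ luc)); rewrite itgB//; last exact: locint_cst.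
rewrite itg_cst; last by lra.
rewrite u0; last by lra.
rewrite sub0r normrN normrM (_ : x + e - (x - e) = 2 * e); last by ring.
rewrite [`|2 * e|]ger0_norm; last by rewrite mulr_ge0// ltW.
move=> h; have : `|u x| * 2 <= eta by rewrite -(ler_pM2r e0) -mulrA.
have := normr_ge0 (u x); lra.
Qed.

(** This makes the choice inside [weak_derivative] harmless. The two primitives represent the same
    [f], so up to constants they agree almost everywhere, by continuity everywhere on [-1, 1], and
    the value at -1 equates the constants. *)
Lemma is_weak_derivative_unique f g1 g2 : L2 f -> L2 g1 -> L2 g2 ->
  is_weak_derivative f g1 -> is_weak_derivative f g2 ->
  {ae mu, forall x, x \in oitv -> g1 x = g2 x}.
Proof.
move=> lf l1 l2 w1 w2.
have [c1 E1] := weak_derivative_repr lf l1 w1.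
have [c2 E2] := weak_derivative_repr lf l2 w2.
have P g : L2 g -> prim (fun x => itg (g \_ oitv) (-1) x) (g \_ oitv).
  by move=> /L2_locint[lg _]; apply: prim_itg => //; exact: restrict_oitv0.
have C g : L2 g -> continuous (fun x => itg (g \_ oitv) (-1) x).
  move=> lg; have [_ lg2] := L2_locint lg.
  by apply/ucont_continuous/(locint_sqr_ucont (P _ lg) lg2); exact: restrict_oitv0.
have E : {in citv, (fun x => itg (g1 \_ oitv) (-1) x + c1) =1
                   (fun x => itg (g2 \_ oitv) (-1) x + c2)}.
  apply: eq_within_ae.
  - apply: continuous_subspaceT => x; apply: cvgD; [exact: C|exact: cvg_cst].
  - apply: continuous_subspaceT => x; apply: cvgD; [exact: C|exact: cvg_cst].
  - by apply: (aeS2 _ E1 E2) => x H1 H2 xo; rewrite -H1// -H2.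
apply: (@ae_eq_of_prim (fun x => itg (g1 \_ oitv) (-1) x)) => //; first exact: P.
have c12 : c1 = c2.
  by have := E (-1); rewrite in_citv !itgxx !add0r; apply; apply/andP; split; lra.
have Ein x : -1 <= x -> x <= 1 -> itg (g1 \_ oitv) (-1) x = itg (g2 \_ oitv) (-1) x.
  move=> x1 x2; have := E x; rewrite in_citv x1 x2 c12 => /(_ isT) /eqP.
  by rewrite (inj_eq (addIr c2)) => /eqP.
have -> : (fun x => itg (g1 \_ oitv) (-1) x) = (fun x => itg (g2 \_ oitv) (-1) x); last exact: P.
apply/funext => x.
have [x1|x1] := leP x (-1); first by rewrite !itg_itv0 ?x1//; exact: restrict_oitv0.
have [x2|x2] := leP x 1; first by rewrite Ein// ltW.
have [lg1 _] := L2_locint l1; have [lg2 _] := L2_locint l2.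
have m1 : (-1 : R) <= 1 by lra.
rewrite (itg_add lg1 m1 (ltW x2)) (itg_add lg2 m1 (ltW x2)) (Ein 1 m1 (lexx _)).
by rewrite !(itg_itv0 (x := 1) (y := x)) ?lexx ?orbT//; exact: restrict_oitv0.
Qed.

Lemma weak_derivativeP f g : L2 g -> is_weak_derivative f g ->
  L2 (weak_derivative f) /\ is_weak_derivative f (weak_derivative f).
Proof. by move=> lg wg; apply: (@xgetPex _ _ [set g | L2 g /\ is_weak_derivative f g]); exists g. Qed.

Lemma continuous_reprP f g : {within citv, continuous g} ->
  {ae mu, forall x, x \in oitv -> g x = f x} -> {in citv, continuous_repr f =1 g}.
Proof.
move=> cg gf.
have [ch hf] : {within citv, continuous (continuous_repr f)} /\
    {ae mu, forall x, x \in oitv -> continuous_repr f x = f x}.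
  apply: (@xgetPex _ _ [set g | {within citv, continuous g} /\
     {ae mu, forall x, x \in oitv -> g x = f x}]).
  by exists g.
apply: eq_within_ae => //.
by apply: (aeS2 _ hf gf) => x h1 h2 xo; rewrite h1// h2.
Qed.

End WeakUniqueness.

(** * Profiles and their energy *)

Section Arclength.
Context {R : realType}.
Implicit Types (s t p q v : R).

Definition arcl s : R := Num.sqrt (1 + s ^+ 2).

Lemma arcl_sqr s : arcl s ^+ 2 = 1 + s ^+ 2.
Proof. by rewrite sqr_sqrtr// addr_ge0// sqr_ge0. Qed.

Lemma arcl_ge1 s : 1 <= arcl s.
Proof.
rewrite -[leLHS]sqrtr1 ler_wsqrtr// lerDl sqr_ge0//.
Qed.

Lemma arcl_gt0 s : 0 < arcl s.
Proof. exact: lt_le_trans (arcl_ge1 s). Qed.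

Lemma arcl_neq0 s : arcl s != 0.
Proof. by rewrite gt_eqF// arcl_gt0. Qed.

Lemma arcl_ge_norm s : `|s| <= arcl s.
Proof.
by rewrite -sqrtr_sqr ler_wsqrtr// lerDr.
Qed.

Lemma arclN s : arcl (- s) = arcl s.
Proof. by rewrite /arcl sqrrN. Qed.

Lemma arcl_le s M : `|s| <= M -> arcl s <= 1 + M.
Proof.
move=> sM; have M0 : 0 <= M by exact: le_trans sM.
rewrite -[leRHS]ger0_norm ?addr_ge0// -sqrtr_sqr ler_wsqrtr//.
have : s ^+ 2 <= M ^+ 2 by rewrite -[s ^+ 2]real_normK ?num_real// ler_sqr ?nnegrE.
nra.
Qed.

Lemma arcl_lip s t : `|arcl t - arcl s| <= `|t - s|.
Proof.
have pos : 0 < arcl t + arcl s by rewrite addr_gt0 ?arcl_gt0.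
rewrite -(ler_pM2r pos) -[in leLHS](gtr0_norm pos) -normrM.
rewrite (_ : (arcl t - arcl s) * (arcl t + arcl s) = (t - s) * (t + s)); last first.
  by rewrite -!subr_sqr !arcl_sqr; ring.
rewrite normrM ler_wpM2l//; apply: (le_trans (ler_normD _ _)).
by rewrite lerD// arcl_ge_norm.
Qed.

Lemma arclV_gt0 s : 0 < (arcl s)^-1.
Proof. by rewrite invr_gt0 arcl_gt0. Qed.

Lemma arclV_le1 s : (arcl s)^-1 <= 1.
Proof. by rewrite invf_le1 ?arcl_gt0// arcl_ge1. Qed.

Lemma arclV_lip s t : `|(arcl t)^-1 - (arcl s)^-1| <= `|t - s|.
Proof.
rewrite (_ : _ - _ = (arcl s - arcl t) * ((arcl t)^-1 * (arcl s)^-1)); last first.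
  by field; rewrite !arcl_neq0.
rewrite normrM -[leRHS]mulr1; apply: ler_pM => //.
  by rewrite distrC arcl_lip.
rewrite gtr0_norm ?mulr_gt0 ?arclV_gt0//.
by rewrite mulr_ile1// ?arclV_le1 ?(ltW (arclV_gt0 _)).
Qed.

Lemma arclVX_lip n s t : `|(arcl t)^-1 ^+ n - (arcl s)^-1 ^+ n| <= n%:R * `|t - s|.
Proof.
elim: n => [|n IHn]; first by rewrite !expr0 subrr normr0 mul0r.
rewrite !exprS (_ : _ - _ = (arcl t)^-1 * ((arcl t)^-1 ^+ n - (arcl s)^-1 ^+ n)
   + ((arcl t)^-1 - (arcl s)^-1) * (arcl s)^-1 ^+ n); last by ring.
apply: (le_trans (ler_normD _ _)); rewrite -natr1 !normrM.
rewrite [leRHS](_ : _ = n%:R * `|t - s| + `|t - s|); last by ring.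
apply: lerD.
  by rewrite -[leRHS]mul1r ler_pM// gtr0_norm ?arclV_gt0// arclV_le1.
rewrite -[leRHS]mulr1 ler_pM ?arclV_lip// ger0_norm ?exprn_ge0 ?(ltW (arclV_gt0 _))//.
by rewrite exprn_ile1 ?arclV_le1 ?(ltW (arclV_gt0 _)).
Qed.

Lemma arcl_continuous : continuous arcl.
Proof.
by apply/ucont_continuous/(@lipschitz_ucont _ _ 1) => x y; rewrite mul1r arcl_lip.
Qed.

Lemma arclVX_continuous n : continuous (fun s => (arcl s)^-1 ^+ n).
Proof.
by apply/ucont_continuous/(@lipschitz_ucont _ _ n%:R) => x y; rewrite arclVX_lip.
Qed.

(** The sine of the angle between the tangent and the axis. Its derivative in [s] is the factor S^-3
    in the curvature q / S^3 of the profile curve. *)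
Definition incline s : R := s / arcl s.

Lemma is_derive_incline s : is_derive s 1 incline ((arcl s)^-1 ^+ 3).
Proof.
have d1 : is_derive s 1 (fun x : R => 1 + x ^+ 2) (2 * s).
  apply: (@is_derive_of_quadratic _ _ _ _ 1) => k.
  by rewrite (_ : _ - _ - _ = k ^+ 2) ?mul1r ?ger0_norm ?sqr_ge0//; ring.
have p0 : 0 < 1 + s ^+ 2 by rewrite ltr_pwDl// sqr_ge0.
have d2 : is_derive s 1 arcl ((2 * arcl s)^-1 * (2 * s)).
  exact: (@is_derive1_comp R Num.sqrt (fun x : R => 1 + x ^+ 2) s _ _ (is_derive1_sqrt p0) d1).
have d3 : is_derive s 1 (fun x => (arcl x)^-1) (- (arcl s) ^- 2 *: ((2 * arcl s)^-1 * (2 * s))).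
  apply: is_deriveV; exact: arcl_neq0.
have := is_deriveM (is_derive_id s (1 : R)) d3.
congr is_derive; rewrite /GRing.scale/= (_ : s * _ = - (s ^+ 2) * (arcl s)^-1 ^+ 3); last first.
  by field; rewrite arcl_neq0.
rewrite mulr1 (_ : s ^+ 2 = arcl s ^+ 2 - 1); last by rewrite arcl_sqr; ring.
by field; rewrite arcl_neq0.
Qed.

(** The mean value theorem reduces this to the Lipschitz bound for the third power of 1 / S, whence
    the 3. *)
Lemma incline_taylor s t :
  `|incline t - incline s - (arcl s)^-1 ^+ 3 * (t - s)| <= 3 * `|t - s| ^+ 2.
Proof.
have K a b : a <= b -> exists2 c, a <= c <= b &
    incline b - incline a = (arcl c)^-1 ^+ 3 * (b - a).
  move=> ab; have ci : {within `[a, b], continuous incline}.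
    apply: continuous_subspaceT => x; apply/differentiable_continuous/derivable1_diffP.
    by case: (is_derive_incline x).
  have [c cab E] := MVT_segment ab (fun x _ => is_derive_incline x) ci.
  by exists c => //; move: cab; rewrite in_itv.
have [c hc ->] : exists2 c, `|c - s| <= `|t - s| &
    incline t - incline s = (arcl c)^-1 ^+ 3 * (t - s).
  have [st|/ltW ts] := leP s t.
    have [c /andP[c1 c2] E] := K _ _ st; exists c => //.
    by rewrite !ger0_norm ?subr_ge0// lerD2r.
  have [c /andP[c1 c2] E] := K _ _ ts; exists c.
    by rewrite distrC [leRHS]distrC !ger0_norm ?subr_ge0// lerD2l lerN2.
  by apply: oppr_inj; rewrite opprB E; ring.
rewrite -mulrBl normrM expr2 mulrA ler_wpM2r//.
by apply: (le_trans (arclVX_lip 3 _ _)); rewrite ler_wpM2l.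
Qed.

(** Bounding S by 1 + |s| in |s| <= k S gives |s| (1 - k) <= k. This is cruder than k / sqrt (1 -
    k^2) but stays rational in [k]. *)
Lemma le_of_incline s k : 0 <= k -> k < 1 -> `|incline s| <= k -> `|s| <= (1 - k)^-1.
Proof.
move=> k0 k1; rewrite normrM normfV [`|arcl s|]gtr0_norm ?arcl_gt0// ler_pdivrMr ?arcl_gt0// => h.
have k1' : 0 < 1 - k by rewrite subr_gt0.
have h2 : arcl s <= 1 + `|s| by exact: arcl_le.
rewrite -[leRHS]mulr1 ler_pdivlMl//.
have : `|s| <= k * (1 + `|s|) by apply: (le_trans h); rewrite ler_wpM2l.
lra.
Qed.

Definition density v p q : R := v * q ^+ 2 * (arcl p)^-1 ^+ 5 + v^-1 * (arcl p)^-1.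

Lemma powR_arc p : (1 + p ^+ 2) `^ (3 / 2) = arcl p ^+ 3.
Proof.
have p0 : 0 <= 1 + p ^+ 2 by rewrite addr_ge0// sqr_ge0.
by rewrite mulrC powRrM powR12_sqrt// powR_mulrn// sqrtr_ge0.
Qed.

Lemma willmore_integrand v p q : 0 < v ->
  (1 / (v * Num.sqrt (1 + p ^+ 2)) - q / (1 + p ^+ 2) `^ (3 / 2)) ^+ 2
    * (v * Num.sqrt (1 + p ^+ 2)) =
  density v p q - 2 * ((arcl p)^-1 ^+ 3 * q).
Proof.
move=> v0; rewrite powR_arc -/(arcl p) /density; field.
by rewrite arcl_neq0 gt_eqF.
Qed.

(** The gap is a perfect square over v S. It vanishes exactly when v |q| = S^2, that is, when the
    principal curvatures 1 / (v S) and q / S^3 have equal modulus. *)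
Lemma density_ge v p q : 0 < v -> 2 * `|(arcl p)^-1 ^+ 3 * q| <= density v p q.
Proof.
move=> v0; have a0 := arclV_gt0 p; rewrite normrM (ger0_norm (exprn_ge0 _ (ltW a0))).
rewrite -subr_ge0.
have -> : density v p q - 2 * ((arcl p)^-1 ^+ 3 * `|q|)
   = (v * `|q| * (arcl p)^-1 ^+ 2 - 1) ^+ 2 * (v^-1 * (arcl p)^-1).
  rewrite /density -[q ^+ 2]real_normK ?num_real//; field.
  by rewrite arcl_neq0 gt_eqF.
by rewrite mulr_ge0 ?sqr_ge0// mulr_ge0 ?(ltW a0)// invr_ge0 ltW.
Qed.

Lemma density_ge0 v p q : 0 < v -> 0 <= density v p q.
Proof. by move=> v0; apply: le_trans (density_ge p q v0); rewrite mulr_ge0. Qed.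

End Arclength.

Section Profile.
Context {R : realType}.
Local Notation mu := (@lebesgue_measure R).
Implicit Types (alpha : R) (v p q w f g : R -> R).

(* p and q are the first two derivatives of v. Because v - alpha vanishes to
   first order at the endpoints, v extends by alpha to the real line. *)
Record profile alpha v p q : Prop := Profile {
  profile_pq : prim p q;
  profile_q2 : locint (fun t => q t ^+ 2);
  profile_vp : prim v p;
  profile_q0 : forall x, x \notin oitv -> q x = 0;
  profile_p0 : forall x, x \notin oitv -> p x = 0;
  profile_v0 : forall x, x \notin oitv -> v x = alpha;
  profile_gt0 : forall x, 0 < v x;
  profile_even : forall x, v (- x) = v x;
  profile_odd : forall x, p (- x) = - p x }.

Definition energy v p q := itg (fun t => density (v t) (p t) (q t)) (-1) 1.

Lemma itg_sqr_le q x y : locint (fun t => q t ^+ 2) ->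
  (forall x, x \notin oitv -> q x = 0) ->
  itg (fun t => q t ^+ 2) x y <= itg (fun t => q t ^+ 2) (-1) 1.
Proof.
move=> lq2 q0; apply: locint_supp_bound => // z; last by rewrite sqr_ge0.
by move=> /q0 ->; rewrite expr0n.
Qed.

Lemma locint_L2 f : measurable_fun [set: R] f -> locint (fun t => f t ^+ 2) -> L2 f.
Proof.
move=> mf lf2.
have mo : measurable (@oitv R) by exact: measurable_itv.
apply/L2P; split; first by apply/(measurable_restrictT _ mo); exact: measurable_funTS.
have -> : EFin \o (fun x => (f \_ oitv) x ^+ 2) = (EFin \o (fun x => f x ^+ 2)) \_ oitv.
  apply/funext => x /=; rewrite /patch; case: ifP => //= _; by rewrite expr0n.
rewrite -integrable_mkcond//; apply: integrableS (locint_itv (-1) 1 lf2) => //.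
by apply: subset_itvl; rewrite bnd_simp.
Qed.

Lemma continuous_L2 f : continuous f -> L2 f.
Proof.
move=> cf; apply: locint_L2; first exact: continuous_measurable_fun.
by apply: locint_continuous => x; apply: cvgM; exact: cf.
Qed.

Lemma arclVX_comp_continuous p n : continuous p -> continuous (fun t => (arcl (p t))^-1 ^+ n).
Proof.
move=> cp t; apply: (@continuous_comp _ _ _ p (fun s => (arcl s)^-1 ^+ n)); first exact: cp.
exact: arclVX_continuous.
Qed.

Lemma incline_prim p q : prim p q -> ucont p ->
  prim (incline \o p) (fun t => (arcl (p t))^-1 ^+ 3 * q t).
Proof.
move=> pq up; apply: (@chain_rule _ incline (fun s => (arcl s)^-1 ^+ 3) p q 3) => //.
- apply: locint_continuousM; last exact: (proj1 pq).
  exact: arclVX_comp_continuous (ucont_continuous up).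
- by move=> x y; exact: incline_taylor.
- by move=> x y; exact: arclVX_lip.
Qed.

Lemma eq_Rintegral_ae f g : measurable_fun oitv f -> measurable_fun oitv g ->
  {ae mu, forall x, x \in oitv -> f x = g x} ->
  \int[mu]_(x in oitv) f x = \int[mu]_(x in oitv) g x.
Proof.
move=> mf mg fg; congr fine; apply: ae_eq_integral.
- exact: measurable_itv.
- exact/measurable_EFinP.
- exact/measurable_EFinP.
- apply: negligibleS fg => x /= nE E; apply: nE => xo; congr EFin; apply: E; exact: mem_set.
Qed.

Lemma L2_measurable f : L2 f -> measurable_fun oitv f.
Proof.
move=> /L2P[mf _]; have mo : measurable (@oitv R) by exact: measurable_itv.
exact/(measurable_restrictT f mo).
Qed.

Lemma measurable_funV_pos (D : set R) f : measurable_fun D f -> (forall x, 0 < f x) ->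
  measurable_fun D (fun x => (f x)^-1).
Proof.
move=> mf f0.
have -> : (fun x => (f x)^-1) = (fun x => f x `^ (-1)).
  by apply/funext => x; rewrite powR_inv1// ltW.
apply: (measurableT_comp (f := fun x : R => x `^ (-1)) _ mf).
exact: measurable_powR.
Qed.

Lemma measurable_density v p q : continuous v -> (forall x, 0 < v x) ->
  measurable_fun oitv p -> measurable_fun oitv q ->
  measurable_fun oitv
    (fun x => density (v x) (p x) (q x) - 2 * ((arcl (p x))^-1 ^+ 3 * q x)).
Proof.
move=> cv v0 mp mq.
have mv : measurable_fun oitv v.
  by apply: measurable_funTS; exact: continuous_measurable_fun.
have ma n : measurable_fun oitv (fun x => (arcl (p x))^-1 ^+ n).
  apply: (measurableT_comp (f := fun s => (arcl s)^-1 ^+ n) _ mp).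
  by apply: continuous_measurable_fun; exact: arclVX_continuous.
have ma1 : measurable_fun oitv (fun x => (arcl (p x))^-1).
  by have := ma 1%N; under eq_fun do rewrite expr1.
apply: measurable_funB; last by apply: measurable_funM => //; exact: measurable_funM.
apply: measurable_funD; apply: measurable_funM => //.
  by apply: measurable_funM => //; exact: measurable_funX.
exact: measurable_funV_pos.
Qed.

Section ProfileTheory.
Context alpha v p q (H : profile alpha v p q).

Let pq := profile_pq H.
Let vp := profile_vp H.
Let q2 := profile_q2 H.
Let q0 := profile_q0 H.
Let v0 := profile_gt0 H.

Lemma profile_hoelder x y :
  (p y - p x) ^+ 2 <= itg (fun t => q t ^+ 2) (-1) 1 * `|y - x|.
Proof. by apply: prim_hoelder pq q2 _ x y => x y; exact: itg_sqr_le. Qed.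

Lemma profile_ucont_p : ucont p.
Proof. exact: hoelder_ucont profile_hoelder. Qed.

Lemma profile_cont_p : continuous p.
Proof. exact: ucont_continuous profile_ucont_p. Qed.

(** Purely qualitative, as the bound depends on the integral of q^2; the uniform bound will come
    from the energy. *)
Lemma profile_bounded_p : exists M, forall x, `|p x| <= M.
Proof.
pose K := itg (fun t => q t ^+ 2) (-1) 1.
have K0 : 0 <= K by apply: itg_ge0 => t; rewrite sqr_ge0.
exists (1 + 2 * K) => x.
have [xo|/(profile_p0 H) ->] := boolP (x \in oitv); last first.
  by rewrite normr0 addr_ge0// mulr_ge0.
have := profile_hoelder (-1) x; rewrite (profile_p0 H (x := -1)); last first.
  by rewrite in_oitv ltxx.
move: xo; rewrite in_oitv => /andP[x1 x2].
rewrite subr0 -/K ger0_norm; last by lra.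
move=> h; have : p x ^+ 2 <= K * 2 by apply: (le_trans h); rewrite ler_wpM2l//; lra.
have := sqr_ge0 (`|p x| - 1); rewrite sqrrB1 real_normK ?num_real//.
have := normr_ge0 (p x); lra.
Qed.

Lemma profile_ucont_v : ucont v.
Proof. by have [M HM] := profile_bounded_p; exact: lipschitz_ucont (prim_lip vp HM). Qed.

Lemma profile_cont_v : continuous v.
Proof. exact: ucont_continuous profile_ucont_v. Qed.

Lemma profile_L2 : [/\ L2 v, L2 p & L2 q].
Proof.
split; [exact: continuous_L2 profile_cont_v|exact: continuous_L2 profile_cont_p|].
by apply: locint_L2 => //; exact: locint_mfun (proj1 pq).
Qed.

Lemma profile_continuous_arcl n : continuous (fun t => (arcl (p t))^-1 ^+ n).
Proof. exact: arclVX_comp_continuous profile_cont_p. Qed.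

Lemma locint_density_parts :
  locint (fun t => v t * (arcl (p t))^-1 ^+ 5 * q t ^+ 2) /\
  continuous (fun t => (v t)^-1 * (arcl (p t))^-1).
Proof.
split.
  apply: locint_continuousM => // t.
  by apply: cvgM; [exact: profile_cont_v|exact: profile_continuous_arcl].
move=> t; apply: cvgM; last by have := @profile_continuous_arcl 1 t; under eq_fun do rewrite expr1.
by apply: cvgV; [rewrite gt_eqF|exact: profile_cont_v].
Qed.

Lemma locint_density : locint (fun t => density (v t) (p t) (q t)).
Proof.
have [l1 l2] := locint_density_parts.
have := locintD l1 (locint_continuous l2); congr locint.
by apply/funext => t; rewrite /density mulrAC.
Qed.

Lemma profile_incline_prim : prim (incline \o p) (fun t => (arcl (p t))^-1 ^+ 3 * q t).
Proof. exact: incline_prim pq profile_ucont_p. Qed.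

(** Weak derivatives only see the values on the open interval, so [w] may be any function that
    agrees with [v] there. *)
Lemma profile_weak_derivative w : {in oitv, w =1 v} ->
  [/\ L2 w, L2 (weak_derivative w), L2 (weak_derivative (weak_derivative w)) &
   [/\ is_weak_derivative w (weak_derivative w),
    is_weak_derivative (weak_derivative w) (weak_derivative (weak_derivative w)),
    {ae mu, forall x, x \in oitv -> weak_derivative w x = p x} &
    {ae mu, forall x, x \in oitv -> weak_derivative (weak_derivative w) x = q x}]].
Proof.
move=> wv; have [Lv Lp Lq] := profile_L2.
have rw : w \_ oitv = v \_ oitv.
  by apply/funext => x; rewrite /patch; case: ifP => // /wv.
have Lw : L2 w by rewrite /L2 rw.
have ww : is_weak_derivative w p.
  move=> phi tphi; rewrite -(prim_weak_derivative vp profile_ucont_v tphi).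
  by apply: eq_Rintegral => x /wv ->.
have [Ldw wdw] := weak_derivativeP Lp ww.
have dwp := is_weak_derivative_unique Lw Ldw Lp wdw ww.
(* The second weak derivative is taken of the chosen [weak_derivative w], not of [p]; the two differ
   on a null set, which the integrals do not see. *)
have wq : is_weak_derivative (weak_derivative w) q.
  move=> phi tphi; rewrite -(prim_weak_derivative pq profile_ucont_p tphi).
  have [_ _ cphi _] := test_function_prim tphi.
  have mphi : measurable_fun oitv (derive1 phi).
    by apply: measurable_funTS; exact: continuous_measurable_fun.
  apply: eq_Rintegral_ae.
  - by apply: measurable_funM => //; exact: L2_measurable.
  - by apply: measurable_funM => //; exact: L2_measurable.
  - by apply: (aeS _ dwp) => x h /h ->.
have [Lddw wddw] := weak_derivativeP Lq wq.
split => //; split => //.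
exact: is_weak_derivative_unique Ldw Lddw Lq wddw wq.
Qed.

Lemma Willmore_profile w : {in oitv, w =1 v} ->
  Willmore w = ((pi / 2) * energy v p q)%:E.
Proof.
move=> wv; have [Lw Ldw Lddw [_ _ dwp ddwq]] := profile_weak_derivative wv.
have [Lv Lp Lq] := profile_L2.
rewrite /Willmore.
set dw := weak_derivative w in Ldw dwp ddwq *.
set ddw := weak_derivative dw in Lddw ddwq *.
have li := proj1 profile_incline_prim.
have ld := locint_density.
have l2 : locint (fun t => density (v t) (p t) (q t) - 2 * ((arcl (p t))^-1 ^+ 3 * q t)).
  by apply: locintB => //; exact: locintZ.
pose F x := density (v x) (dw x) (ddw x) - 2 * ((arcl (dw x))^-1 ^+ 3 * ddw x).
pose G x := density (v x) (p x) (q x) - 2 * ((arcl (p x))^-1 ^+ 3 * q x).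
(* [F] is built on the chosen weak derivatives and [G] on [p] and [q]. They are first exchanged
   inside the extended integral, almost everywhere; [G] is then integrable, so its integral is
   finite and can be split. *)
suff E : (\int[mu]_(x in oitv) (F x)%:E)%E = (energy v p q)%:E.
  rewrite [RHS]EFinM -E; congr (_ * _)%E.
  by apply: eq_integral => x xo; rewrite (wv _ xo) willmore_integrand.
transitivity (\int[mu]_(x in oitv) (G x)%:E)%E.
  apply: ae_eq_integral.
  - exact: measurable_itv.
  - apply/measurable_EFinP; apply: (measurable_density profile_cont_v v0).
      exact: (L2_measurable Ldw).
    exact: (L2_measurable Lddw).
  - apply/measurable_EFinP; apply: (measurable_density profile_cont_v v0).
      exact: (L2_measurable Lp).
    exact: (L2_measurable Lq).
  - apply: negligibleS (negligibleU dwp ddwq) => x /= nE.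
    apply: contrapT => /not_orP[/contrapT h1 /contrapT h2]; apply: nE => xo.
    by rewrite /F /G h1 ?h2//; exact: mem_set.
have -> : (\int[mu]_(x in oitv) (G x)%:E)%E = (itg G (-1) 1)%:E.
  rewrite -itg_oitv// /Rintegral fineK//; apply: integrable_fin_num; first exact: measurable_itv.
  apply: integrableS (locint_itv (-1) 1 l2) => //; first exact: measurable_itv.
  by apply: subset_itvl; rewrite bnd_simp.
congr EFin; rewrite /G itgB//; last exact: locintZ.
have pm x : `|x| = 1 -> p x = 0.
  move=> x1; apply: (profile_p0 H); rewrite in_oitv -ltr_norml x1 ltxx//.
have := (proj2 profile_incline_prim) (-1) 1 => /= E.
rewrite itgZ// -E; last by lra.
by rewrite !pm ?normrN1 ?normr1// subrr mulr0 subr0.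
Qed.

End ProfileTheory.

Lemma profile_admissible alpha v p q : 0 < alpha -> profile alpha v p q -> admissible alpha v.
Proof.
move=> a0 H.
have [Lv Ldv Lddv [wv wdv dvp _]] := profile_weak_derivative H (fun x _ => erefl (v x)).
have E : {in citv, continuous_repr (weak_derivative v) =1 p}.
  apply: continuous_reprP; first exact: continuous_subspaceT (profile_cont_p H).
  by apply: (aeS _ dvp) => x h /h.
split.
- split; last exact: continuous_subspaceT (profile_cont_v H).
  by split; split => //; [exists (weak_derivative v)|exists (weak_derivative (weak_derivative v))].
- by move=> x _; exact: (profile_gt0 H).
- by rewrite !(profile_v0 H)// in_oitv ?ltxx ?andbF.
- by rewrite /= !E ?in_citv ?lexx ?andbT ?(profile_p0 H) ?in_oitv ?ltxx ?andbF//; lra.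
- by move=> x _; rewrite (profile_even H).
Qed.

(** Evenness makes the integrals of [p] over [x, x + h] and over its mirror image opposite, and
    uniform continuity compares each of them with h times an endpoint value. *)
Lemma even_prim_odd v p : prim v p -> ucont p -> (forall x, v (- x) = v x) ->
  forall x, p (- x) = - p x.
Proof.
move=> [lp vp] up ev x; apply/eqP; rewrite -subr_eq0 opprK -normr_le0.
apply/ler_addgt0Pr => e e0; rewrite add0r.
have e20 : 0 < e / 2 by rewrite divr_gt0.
have [d d0 Hd] := up _ e20.
have h0 : 0 < d / 2 by rewrite divr_gt0.
have hd : d / 2 < d by rewrite ltr_pdivrMr// ltr_pMr// ltr1n.
set h := d / 2 in h0 hd.
have nearby y a : a <= y -> y <= a + h -> forall b, (b == a) || (b == a + h) -> `|p y - p b| <= e / 2.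
  move=> ay yh b /orP[]/eqP ->; apply: Hd; rewrite ltr_norml; apply/andP; split; lra.
have avg a b : (b == a) || (b == a + h) -> `|itg p a (a + h) - p b * h| <= e / 2 * h.
  move=> ba; have aah : a <= a + h by lra.
  have cE k : itg (fun=> k) a (a + h) = k * h by rewrite itg_cst//; ring.
  rewrite -(cE (p b)) -(cE (e / 2)) -itgB//; last exact: locint_cst.
  apply: le_trans (itg_norm _ _ _) _; first by apply: locintB => //; exact: locint_cst.
  apply: itg_le; [|exact: locint_cst|].
    by apply/locint_norm/locintB => //; exact: locint_cst.
  by move=> t at_ tah; exact: (nearby t a (ltW at_) tah).
have h1 := avg x x; have h2 := avg (- x - h) (- x).
rewrite eqxx in h1; have {}h1 := h1 isT.
rewrite subrK eqxx orbT in h2; have {}h2 := h2 isT.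
have E : itg p (- x - h) (- x) = - itg p x (x + h).
  rewrite -!vp; [|lra|lra].
  by rewrite -opprD !ev opprB.
rewrite E in h2.
rewrite -(ler_pM2r h0) -[X in _ * X <= _](gtr0_norm h0) -normrM.
rewrite (_ : (p (- x) + p x) * h = - ((itg p x (x + h) - p x * h)
   + (- itg p x (x + h) - p (- x) * h))); last by ring.
rewrite normrN; apply: (le_trans (ler_normD _ _)); lra.
Qed.

(** Integrating twice from -1 produces continuous representatives. The order matters:
    [continuous_repr] transports the boundary conditions to [p], so that [p] vanishes outside (-1,
    1), and only then is its primitive [v] constant on either side. *)
Lemma admissible_profile alpha w : 0 < alpha -> admissible alpha w ->
  exists v p q, profile alpha v p q /\ {in citv, w =1 v}.
Proof.
move=> a0 [[[[Lw [dw0 Ldw0 wdw0]] [Ldw [ddw0 Lddw0 wddw0]]] cw] wgt0 [w1 wm1] [dw1 dwm1] wev].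
have [_ wdw] := weak_derivativeP Ldw0 wdw0.
have [Lddw wddw] := weak_derivativeP Lddw0 wddw0.
set dw := weak_derivative w in Ldw wdw Lddw wddw dw1 dwm1 *.
pose q := weak_derivative dw \_ oitv.
have [lq lq2] := L2_locint Lddw; rewrite -/q in lq lq2.
have q0 x : x \notin oitv -> q x = 0 by exact: restrict_oitv0.
have [c Ec] := weak_derivative_repr Ldw Lddw wddw.
pose p x := itg q (-1) x + c.
have pq0 := prim_itg lq q0.
have pq : prim p q.
  by split => // x y xy; rewrite -(proj2 pq0)// /p; ring.
have up : ucont p := locint_sqr_ucont pq lq2 q0.
have cp := ucont_continuous up.
have pE : {in citv, continuous_repr dw =1 p}.
  apply: continuous_reprP; first exact: continuous_subspaceT.
  by apply: (aeS _ Ec) => x h /h.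
have pm1 : p (-1) = 0 by rewrite -pE ?in_citv//; apply/andP; split; lra.
have p1 : p 1 = 0 by rewrite -pE ?in_citv//; apply/andP; split; lra.
have p0 x : x \notin oitv -> p x = 0.
  rewrite in_oitv negb_and -!leNgt => /orP[x1|x1].
    have := (proj2 pq) _ _ x1; rewrite pm1 itg_itv0 ?lexx//; lra.
  have := (proj2 pq) _ _ x1; rewrite p1 itg_itv0 ?lexx ?orbT//; lra.
have lp : locint p by exact: locint_continuous.
have [c' Ec'] := weak_derivative_repr Lw Ldw wdw.
have vp0 := prim_itg lp p0.
pose v x := itg p (-1) x + c'.
have vp : prim v p by split => // x y xy; rewrite -(proj2 vp0)// /v; ring.
have bp : exists M, forall x, `|p x| <= M.
  have /compact_bounded[M [_ HM]] : compact (p @` `[-1, 1]).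
    apply: continuous_compact; last exact: segment_compact.
    exact: continuous_subspaceT.
  have M1 : M < `|M| + 1 by rewrite (le_lt_trans (ler_norm _))// ltrDl.
  exists (`|M| + 1) => x; have [xo|/p0 ->] := boolP (x \in oitv); last by rewrite normr0 addr_ge0.
  apply: (HM _ M1); exists x => //=; move: xo; rewrite in_oitv in_itv/= => /andP[h1 h2].
  by rewrite !ltW.
have uv : ucont v by have [M HM] := bp; exact: lipschitz_ucont (prim_lip vp HM).
have wv : {in citv, w =1 v}.
  apply: eq_within_ae => //; first exact: continuous_subspaceT (ucont_continuous uv).
  (* The representation of [w] integrates the chosen derivative [dw], whereas [v] integrates [p];
     the integrands agree almost everywhere. *)
  apply: (aeS _ Ec') => x h /[dup] xo /h ->; congr (_ + _).
  congr fine; apply: ae_eq_integral => //.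
  - by apply/measurable_EFinP/measurable_funTS; have [/locint_mfun] := L2_locint Ldw.
  - by apply/measurable_EFinP/measurable_funTS; exact: locint_mfun.
  - apply: negligibleS Ec => t /= nE E; apply: nE => tx; congr EFin.
    have [to|to] := boolP (t \in oitv); first by rewrite restrict_oitv// E.
    by rewrite restrict_oitv0// p0.
have v1 : v 1 = alpha by rewrite -w1 wv// in_citv; apply/andP; split; lra.
have vm1 : v (-1) = alpha by rewrite -wm1 wv// in_citv; apply/andP; split; lra.
have v0 x : x \notin oitv -> v x = alpha.
  rewrite in_oitv negb_and -!leNgt => /orP[x1|x1].
    have := (proj2 vp) _ _ x1; rewrite vm1 itg_itv0 ?lexx//; lra.
  have := (proj2 vp) _ _ x1; rewrite v1 itg_itv0 ?lexx ?orbT//; lra.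
have oc x : x \in oitv -> x \in citv.
  by rewrite in_oitv in_citv => /andP[h1 h2]; rewrite !ltW.
have on x : (- x \in oitv) = (x \in oitv).
  by rewrite !in_oitv ltrN2 ltrNl andbC.
have ve x : v (- x) = v x.
  have [xo|xo] := boolP (x \in oitv); last by rewrite !v0// on.
  by rewrite -!wv ?oc ?on//; symmetry; apply: wev; exact: oc.
exists v, p, q; split => //; split => //.
- move=> x; have [xo|xo] := boolP (x \in oitv); last by rewrite v0.
  by rewrite -wv ?oc//; exact: wgt0.
- exact: even_prim_odd vp up ve.
Qed.

End Profile.

(** * A priori bounds *)

Section APriori.
Context {R : realType}.
Implicit Types (alpha : R) (v p q w f g : R -> R).

(** Apply ln x <= x - 1 to t / s and to s / t: the first bounds the remainder above by 0, the second
    below by - (t - s)^2 / (s t). *)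
Lemma ln_taylor (m s t : R) : 0 < m -> m <= s -> m <= t ->
  `|ln t - ln s - s^-1 * (t - s)| <= m^-1 ^+ 2 * `|t - s| ^+ 2.
Proof.
move=> m0 ms mt; have s0 := lt_le_trans m0 ms; have t0 := lt_le_trans m0 mt.
have up (a b : R) : 0 < a -> 0 < b -> ln a - ln b <= a / b - 1.
  move=> a0 b0; rewrite -ln_div ?posrE//.
  have := @le_ln1Dx R (a / b - 1).
  rewrite (_ : 1 + (a / b - 1) = a / b); last by ring.
  by apply; rewrite ltrBrDl subrr divr_gt0.
have h1 := up _ _ t0 s0; have h2 := up _ _ s0 t0.
have e1 : t / s - 1 = s^-1 * (t - s) by field; rewrite gt_eqF.
have e2 : s / t - 1 = - (s^-1 * (t - s)) + (s^-1 * t^-1) * (t - s) ^+ 2.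
  by field; rewrite !gt_eqF.
have h3 : s^-1 * t^-1 * (t - s) ^+ 2 <= m^-1 ^+ 2 * `|t - s| ^+ 2.
  rewrite real_normK ?num_real// ler_wpM2r ?sqr_ge0// expr2.
  by apply: ler_pM; rewrite ?invr_ge0 ?(ltW s0) ?(ltW t0)// lef_pV2.
rewrite ler_norml; apply/andP; split; last first.
  have : 0 <= s^-1 * t^-1 * (t - s) ^+ 2.
    by rewrite mulr_ge0 ?sqr_ge0// mulr_ge0// invr_ge0 ltW.
  lra.
lra.
Qed.

Lemma inv_lip (m s t : R) : 0 < m -> m <= s -> m <= t ->
  `|t^-1 - s^-1| <= m^-1 ^+ 2 * `|t - s|.
Proof.
move=> m0 ms mt; have s0 := lt_le_trans m0 ms; have t0 := lt_le_trans m0 mt.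
rewrite (_ : _ - _ = - (s^-1 * t^-1) * (t - s)); last by field; rewrite !gt_eqF.
rewrite normrM normrN ler_wpM2r// ger0_norm ?mulr_ge0 ?invr_ge0 ?(ltW s0) ?(ltW t0)// expr2.
by apply: ler_pM; rewrite ?invr_ge0 ?(ltW s0) ?(ltW t0)// lef_pV2.
Qed.

Lemma itg_le_sub f a x y b : locint f -> (forall t, 0 <= f t) ->
  a <= x -> x <= y -> y <= b -> itg f x y <= itg f a b.
Proof.
move=> lf f0 ax xy yb.
rewrite (itg_add lf ax (le_trans xy yb)) (itg_add lf xy yb).
have := itg_ge0 a x f0; have := itg_ge0 y b f0; lra.
Qed.

Section Bounds.
Context alpha v p q (H : profile alpha v p q).

Let dens t := density (v t) (p t) (q t).
Let dens0 t : 0 <= dens t.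
Proof. exact/density_ge0/(profile_gt0 H). Qed.
Let ld : locint dens. Proof. exact: locint_density H. Qed.

(* AM-GM bounds the total variation of the inclination by half the energy;
   by symmetry it climbs from 0 to its maximum four times. *)
Lemma incline_le_energy x : `|incline (p x)| <= energy v p q / 8.
Proof.
have E0 : 0 <= energy v p q by apply: itg_ge0.
have H0 y : p y = 0 -> incline (p y) = 0 by move=> ->; rewrite /incline mul0r.
have var a b : a <= b -> `|incline (p b) - incline (p a)| <= itg dens a b / 2.
  move=> ab; have pI := profile_incline_prim H.
  apply: (le_trans (prim_norm pI ab)).
  rewrite ler_pdivlMr// mulrC -itgZ; last exact: locint_norm (proj1 pI).
  apply: itg_le => //; first exact/locintZ/locint_norm/(proj1 pI).
  by move=> t _ _; exact/density_ge/(profile_gt0 H).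
have incN y : `|incline (p (- y))| = `|incline (p y)|.
  by rewrite (profile_odd H) /incline arclN mulNr normrN.
wlog x0 : x / 0 <= x.
  move=> W; case: (leP 0 x) => [/W//|/ltW x0].
  by rewrite -incN; apply: W; rewrite oppr_ge0.
have [x1|/ltW x1] := leP x 1; last first.
  rewrite H0 ?normr0 ?divr_ge0//; apply: (profile_p0 H).
  by rewrite in_oitv negb_and -!leNgt x1 orbT.
have p00 : p 0 = 0 by have := profile_odd H 0; rewrite oppr0; lra.
have pe y : y = 1 \/ y = -1 -> p y = 0.
  by move=> [] ->; apply: (profile_p0 H); rewrite in_oitv ltxx ?andbF.
have xm : -1 <= - x by rewrite lerN2.
have xn : - x <= 0 by rewrite oppr_le0.
have := var _ _ xm; have := var _ _ xn; have := var _ _ x0; have := var _ _ x1.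
rewrite (H0 1 (pe _ (or_introl erefl))) (H0 (-1) (pe _ (or_intror erefl))) (H0 0 p00).
rewrite !sub0r !subr0 !normrN !incN.
have : energy v p q = itg dens (-1) (- x) + itg dens (- x) 0 + itg dens 0 x + itg dens x 1.
  have m10 : (-1 : R) <= 0 by lra.
  by rewrite -(itg_add ld xm xn) -(itg_add ld m10 x0) -(itg_add ld (le_trans m10 x0) x1).
lra.
Qed.

(** This bound depends on [v]. It provides the quadratic remainder of ln along [v] that the chain
    rule asks for; the uniform lower bound is then deduced from the energy. *)
Lemma profile_min : exists2 m, 0 < m & forall x, m <= v x.
Proof.
have cv := profile_cont_v H.
have [c _ Hc] := @EVT_min R v (-1) 1 (ltac:(lra)) (continuous_subspaceT cv).
exists (Num.min (v c) alpha).
  rewrite lt_min (profile_gt0 H) -(profile_v0 H (x := 1)) ?(profile_gt0 H)//.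
  by rewrite in_oitv ltxx andbF.
move=> x; rewrite ge_min; have [xo|/(profile_v0 H) ->] := boolP (x \in oitv).
  apply/orP; left; apply: Hc; move: xo; rewrite in_oitv in_itv/= => /andP[h1 h2].
  by rewrite !ltW.
by rewrite lexx orbT.
Qed.

Lemma ln_le_energy (C : R) : (forall x, `|p x| <= C) ->
  forall x, `|ln (v x) - ln alpha| <= C * (1 + C) * energy v p q.
Proof.
move=> pC x.
have C0 : 0 <= C := le_trans (normr_ge0 _) (pC 0).
have E0 : 0 <= energy v p q by exact: itg_ge0.
have [xo|/(profile_v0 H) ->] := boolP (x \in oitv); last first.
  by rewrite subrr normr0 !mulr_ge0// addr_ge0.
have [x1 x2] : -1 < x /\ x < 1 by move: xo; rewrite in_oitv => /andP.
have [m m0 Hm] := profile_min.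
have cvi : continuous (fun t => (v t)^-1).
  by move=> t; apply: cvgV; [rewrite gt_eqF// (profile_gt0 H)|exact: profile_cont_v H _].
have lvp : locint (fun t => (v t)^-1 * p t).
  by apply: locint_continuousM => //; apply: locint_continuous; exact: profile_cont_p H.
have P : prim (@ln R \o v) (fun t => (v t)^-1 * p t).
  apply: (@chain_rule _ (@ln R) (fun s => s^-1) v p (m^-1 ^+ 2)) => //.
  - exact: profile_vp H.
  - exact: profile_ucont_v H.
  - by rewrite sqr_ge0.
  - by move=> y z; exact: ln_taylor.
  - by move=> y z; exact: inv_lip.
have := prim_norm P (ltW x1); rewrite /= (profile_v0 H (x := -1)); last first.
  by rewrite in_oitv ltxx.
move=> h; apply: (le_trans h); rewrite /energy -/dens.
apply: (@le_trans _ _ (C * (1 + C) * itg dens (-1) x)); last first.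
  rewrite ler_wpM2l ?mulr_ge0 ?addr_ge0//.
  by apply: itg_le_sub => //; exact: ltW.
rewrite -itgZ//; apply: itg_le; [exact: locint_norm|exact: locintZ|] => t _ _.
have v0 := profile_gt0 H t.
rewrite normrM normfV (gtr0_norm v0) mulrC -mulrA ler_pM ?invr_ge0 ?(ltW v0)//.
(* Since S <= 1 + C, the factor 1 / v is at most 1 + C times 1 / (v S), a summand of the density.
   The other factor [C] bounds |p|. *)
apply: (@le_trans _ _ ((1 + C) * ((v t)^-1 * (arcl (p t))^-1))).
  rewrite mulrCA -[leLHS]mulr1 ler_wpM2l ?invr_ge0 ?(ltW v0)//.
  by rewrite ler_pdivlMr ?arcl_gt0// mul1r arcl_le.
rewrite ler_wpM2l ?addr_ge0// /dens /density lerDr.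
apply: mulr_ge0; first exact: mulr_ge0 (ltW v0) (sqr_ge0 _).
exact/exprn_ge0/ltW/arclV_gt0.
Qed.

Lemma itg_sqr_le_energy (c C : R) : 0 < c -> (forall x, c <= v x) -> (forall x, `|p x| <= C) ->
  itg (fun t => q t ^+ 2) (-1) 1 <= c^-1 * (1 + C) ^+ 5 * energy v p q.
Proof.
move=> c0 cv pC.
have C0 : 0 <= C := le_trans (normr_ge0 _) (pC 0).
have C1 : 0 < 1 + C by rewrite ltr_pwDl.
rewrite /energy -/dens -itgZ//; apply: itg_le; [exact: profile_q2 H|exact: locintZ|] => t _ _.
have v0 := profile_gt0 H t.
apply: (@le_trans _ _ (c^-1 * (1 + C) ^+ 5 * (v t * q t ^+ 2 * (arcl (p t))^-1 ^+ 5))); last first.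
  rewrite ler_wpM2l ?mulr_ge0 ?invr_ge0 ?exprn_ge0 ?(ltW c0) ?(ltW C1)//.
  by rewrite /dens /density lerDl mulr_ge0 ?invr_ge0 ?(ltW v0)// ltW ?arcl_gt0.
(* Regrouped as (v / c) ((1 + C) / S)^5 q^2, where the first two factors are at least 1. *)
rewrite (_ : _ * _ * _ = (c^-1 * v t) * ((1 + C) ^+ 5 * (arcl (p t))^-1 ^+ 5) * q t ^+ 2); last by ring.
rewrite -[leLHS]mul1r ler_wpM2r ?sqr_ge0//.
rewrite -[leLHS]mulr1 ler_pM//; first by rewrite ler_pdivlMl// mulr1.
rewrite -exprMn exprn_ege1// ler_pdivlMr ?arcl_gt0// mul1r.
exact: arcl_le.
Qed.

End Bounds.

Lemma uniform_bounds alpha (E : R) : 0 < alpha -> E < 8 ->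
  exists C c M K : R, 0 < c /\ forall v p q, profile alpha v p q -> energy v p q <= E ->
    [/\ forall x, `|p x| <= C, forall x, c <= v x, forall x, v x <= M
      & itg (fun t => q t ^+ 2) (-1) 1 <= K].
Proof.
move=> a0 E8.
(* [C] comes from [le_of_incline] at k = E / 8, which is below 1 because E < 8; [B] bounds the
   deviation of ln v from ln alpha. All constants depend on [alpha] and [E] alone. *)
pose C := (1 - E / 8)^-1; pose B := C * (1 + C) * E.
pose c := expR (ln alpha - B).
exists C, c, (expR (ln alpha + B)), (c^-1 * (1 + C) ^+ 5 * E).
have c0 : 0 < c by exact: expR_gt0.
split => // v p q H vE.
have E0 : 0 <= energy v p q.
  by apply: itg_ge0 => t; exact/density_ge0/(profile_gt0 H).
have E1 : 0 <= E := le_trans E0 vE.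
have pC x : `|p x| <= C.
  apply: le_of_incline; [by rewrite divr_ge0|by rewrite ltr_pdivrMr// mul1r|].
  by apply: (le_trans (incline_le_energy H x)); rewrite ler_wpM2r.
have C0 : 0 <= C := le_trans (normr_ge0 _) (pC 0).
have lnB x : `|ln (v x) - ln alpha| <= B.
  apply: (le_trans (ln_le_energy H pC x)).
  by rewrite ler_wpM2l// mulr_ge0// addr_ge0.
have vE' x : v x = expR (ln (v x)) by rewrite lnK// posrE (profile_gt0 H).
have cv x : c <= v x.
  by rewrite vE' ler_expR; have := lnB x; rewrite ler_norml => /andP[]; lra.
split => //.
- by move=> x; rewrite vE' ler_expR; have := lnB x; rewrite ler_norml => /andP[]; lra.
- apply: (le_trans (itg_sqr_le_energy H c0 cv pC)).
  by rewrite ler_wpM2l// mulr_ge0 ?invr_ge0 ?(ltW c0)// exprn_ge0// addr_ge0.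
Qed.

End APriori.

(** * Reconstruction of a derivative from difference quotients *)

Section L2Limit.
Context {R : realType}.
Local Notation mu := (@lebesgue_measure R).
Implicit Types (p q f g h : R -> R).

Lemma locint_itvoo f x y : locint f -> mu.-integrable `]x, y[ (EFin \o f).
Proof.
move=> lf; apply: integrableS (locint_itv x y lf) => //.
by apply: subset_itvl; rewrite bnd_simp.
Qed.

Lemma itg_oo f x y : locint f -> (itg f x y)%:E = (\int[mu]_(t in `]x, y[) (f t)%:E)%E.
Proof.
move=> lf; rewrite /itg -Rintegral_itv_bndo_bndc; last exact: locint_itvoo.
rewrite /Rintegral fineK//.
by apply: integrable_fin_num => //; exact: locint_itvoo.
Qed.

Lemma sum_halves n : \sum_(0 <= j < n) (2 : R) ^- j <= 2.
Proof.
suff -> : \sum_(0 <= j < n) (2 : R) ^- j = 2 - 2 * 2 ^- n.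
  by rewrite lerBlDr lerDl mulr_ge0// invr_ge0 exprn_ge0.
elim: n => [|n IHn]; first by rewrite big_nil expr0 invr1; ring.
rewrite big_nat_recr//= IHn exprS; field.
by rewrite expf_eq0 pnatr_eq0 andbF.
Qed.

(** The argument of Riesz and Fischer. Squared increments of size 4^-j give L^1 increments of order
    2^-j; the sum [h] of their moduli is integrable, hence finite almost everywhere, so the sequence
    converges there, dominated by |f_0| + h. *)
Lemma L2_cauchy_limit (f : nat -> R -> R) :
  (forall j, locint (f j)) -> (forall j, locint (fun t => (f j.+1 t - f j t) ^+ 2)) ->
  (forall j, itg (fun t => (f j.+1 t - f j t) ^+ 2) (-1) 1 <= 4 ^- j) ->
  exists q, [/\ locint q, forall x, x \notin oitv -> q x = 0,
    {ae mu, forall x, x \in oitv -> f j x @[j --> \oo] --> q x} &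
    forall x : R, -1 <= x -> x <= 1 -> itg (f j) (-1) x @[j --> \oo] --> itg q (-1) x].
Proof.
move=> lf lu2 u2.
pose u j t := f j.+1 t - f j t.
have lu j : locint (u j) by exact: locintB.
have lsu j : locint (fun t => u j t ^+ 2) by exact: lu2.
have lnu j : locint (fun t => `|u j t|) by exact: locint_norm.
have un j : itg (fun t => `|u j t|) (-1) 1 <= 2 * 2 ^- j.
  have p2 : (0 : R) < 2 ^+ j by rewrite exprn_gt0.
  (* Weighted AM-GM, |u| <= (2^-j + 2^j u^2) / 2, which integrates to at most (3 / 2) 2^-j over an
     interval of length 2. *)
  apply: (@le_trans _ _ (itg (fun t => 2 ^- j + 2 ^+ j * u j t ^+ 2) (-1) 1 / 2)).
    rewrite ler_pdivlMr// mulrC -itgZ//; apply: itg_le.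
    - exact: locintZ.
    - by apply: locintD; [exact: locint_cst|exact: locintZ].
    - move=> t _ _; rewrite -subr_ge0 -(@pmulr_rge0 _ (2 ^+ j))//.
      rewrite -[u j t ^+ 2]real_normK ?num_real//.
      rewrite (_ : _ * _ = (1 - 2 ^+ j * `|u j t|) ^+ 2) ?sqr_ge0//.
      by field; rewrite gt_eqF.
  rewrite itgD; [|exact: locint_cst|exact: locintZ].
  rewrite itgZ// itg_cst; last by lra.
  have h4 : 2 ^+ j * itg (fun t => u j t ^+ 2) (-1) 1 <= 2 ^- j.
    rewrite -ler_pdivlMl//; apply: (le_trans (u2 j)).
    by rewrite -invfM -exprMn (_ : 2 * 2 = 4)//; ring.
  have : (0 : R) < 2 ^- j by rewrite invr_gt0.
  lra.
pose D : set R := `]-1, 1[%classic.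
have mD : measurable D by exact: measurable_itv.
pose h t := (\sum_(j <oo) (`|u j t|)%:E)%E.
have mEu j : measurable_fun D (fun t => (`|u j t|)%:E).
  by apply/measurable_EFinP/measurable_funTS; exact: locint_mfun (lnu j).
have mh : measurable_fun D h.
  apply: (@ge0_emeasurable_sum _ _ _ D (fun j t => (`|u j t|)%:E) xpredT) => //.
have h0 t : (0 <= h t)%E by apply: nneseries_ge0 => j _ _; rewrite lee_fin.
have ih : (\int[mu]_(t in D) h t <= 4%:E)%E.
  rewrite integral_nneseries//.
  apply: lime_le.
    by apply: is_cvg_nneseries => j _ _; apply: integral_ge0 => t _; rewrite lee_fin.
  apply: nearW => n.
  apply: (@le_trans _ _ (\sum_(0 <= j < n) (2 * 2 ^- j)%:E)%E).
    by apply: lee_sum => j _; rewrite -itg_oo// lee_fin.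
  rewrite sumEFin lee_fin -mulr_sumr (_ : 4 = 2 * 2); last by ring.
  by rewrite ler_pM2l// sum_halves.
have inth : mu.-integrable D h.
  apply/integrableP; split => //.
  rewrite (@eq_integral _ _ _ mu D h); last by move=> t _; rewrite gee0_abs.
  by apply: le_lt_trans ih _; rewrite ltry.
have aeh : {ae mu, forall x, D x -> h x \is a fin_num}.
  by apply: (@integrable_ae _ _ _ mu D _ h inth); exact: measurable_itv.
have cvgf t : h t \is a fin_num -> cvgn (f ^~ t).
  move=> hfin.
  have : cvgn (series (fun j => u j t)).
    apply: normed_cvg.
    apply: nondecreasing_is_cvgn.
      apply/nondecreasing_seqP => n.
      change (series (fun j => `|u j t|) n <= series (fun j => `|u j t|) n.+1).
      by rewrite seriesSr lerDl.
    exists (fine (h t)) => _ [n _ <-].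
    rewrite -lee_fin fineK// /series/= -sumEFin.
    by apply: nneseries_lim_ge => j _ _; rewrite lee_fin.
  have -> : series (fun j => u j t) = [sequence f n t - f 0%N t]_n.
    exact: (telescopeK (fun n => f n t)).
  move=> c; have -> : f ^~ t = (fun n => (f n t - f 0%N t) + f 0%N t).
    by apply/funext => n; rewrite subrK.
  by apply: is_cvgD => //; exact: is_cvg_cst.
(* The upper limit is measurable without reference to the null set on which convergence may fail. *)
pose q : R -> R := (fun t => fine (limn_esup (fun j => (f j t)%:E))) \_ oitv.
have fq t : t \in oitv -> h t \is a fin_num -> f j t @[j --> \oo] --> q t.
  move=> to /cvgf /cvg_ex[l fl]; suff -> : q t = l by [].
  rewrite /q restrict_oitv//.
  have /cvg_limn_einf_sup[_ ->] // : (f j t)%:E @[j --> \oo] --> l%:E.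
  by apply/cvg_EFin => //; exact: nearW.
have q0 x : x \notin oitv -> q x = 0 by exact: restrict_oitv0.
have aefq : {ae mu, forall x, x \in oitv -> f j x @[j --> \oo] --> q x}.
  by apply: (aeS _ aeh) => t H to; apply: fq => //; apply: H; exact: set_mem.
have mq : measurable_fun D (EFin \o q).
  apply/measurable_EFinP.
  apply: (eq_measurable_fun (fun t => fine (limn_esup (fun j => (f j t)%:E)))).
    by move=> t tD; rewrite /q restrict_oitv.
  apply: measurableT_comp; first exact: fine_measurable.
  apply: measurable_fun_limn_esup => j.
  by apply/measurable_EFinP/measurable_funTS; exact: locint_mfun.
pose g (t : R) : \bar R := ((`|f 0%N t|)%:E + h t)%E.
have intg : mu.-integrable D g.
  by apply: integrableD => //; apply: locint_itvoo; exact: locint_norm.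
have dom t n : (`|(f n t)%:E| <= g t)%E.
  rewrite (_ : f n t = f 0%N t + \sum_(0 <= j < n) u j t); last first.
    by rewrite telescope_sumr// addrC subrK.
  rewrite EFinD; apply: (le_trans (lee_abs_add _ _)); apply: leeD => //.
  apply: (@le_trans _ _ (\sum_(0 <= j < n) (`|u j t|)%:E)%E).
    by rewrite sumEFin lee_fin ler_norm_sum.
  by apply: nneseries_lim_ge => j _ _; rewrite lee_fin.
have DC (x : R) : -1 <= x -> x <= 1 -> mu.-integrable `]-1, x[ (EFin \o q) /\
    (itg (f j) (-1) x)%:E @[j --> \oo] --> (\int[mu]_(t in `](-1)%R, x[) (q t)%:E)%E.
  move=> x1 x2.
  have sub : `]-1, x[ `<=` D by apply: subset_itvl; rewrite bnd_simp.
  have mfx n : measurable_fun `]-1, x[ (fun t => (f n t)%:E).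
    by apply/measurable_EFinP/measurable_funTS; exact: locint_mfun.
  have aex : {ae mu, forall t, `]-1, x[%classic t -> (f n t)%:E @[n --> \oo] --> (q t)%:E}.
    apply: (aeS _ aefq) => t H tx; apply/cvg_EFin; first exact: nearW.
    by apply: H; apply: mem_set; exact: sub.
  have gx : mu.-integrable `]-1, x[ g by apply: integrableS intg.
  have domx : {ae mu, forall t n, `]-1, x[%classic t -> (`|(f n t)%:E| <= g t)%E}.
    by apply: aeW => t n _; exact: dom.
  have mqx : measurable_fun `]-1, x[ (EFin \o q) by exact: measurable_funS sub mq.
  have [iq _ cv] := @dominated_convergence _ _ _ mu `]-1, x[%classic (measurable_itv _)
    (fun n t => (f n t)%:E) (EFin \o q) g mfx mqx aex gx domx.
  split => //; move: cv; apply: cvg_trans; apply: near_eq_cvg.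
  by apply: nearW => j /=; rewrite itg_oo.
have lq : locint q.
  have [iq _] := DC 1 ltac:(lra) (lexx _).
  have -> : q = q \_ `]-1, 1[.
    by rewrite /q; apply/funext => t; rewrite /patch; case: ifP.
  exact: locint_restrict.
exists q; split => // x x1 x2; have [_] := DC x x1 x2.
by rewrite -itg_oo// => /fine_cvgP[].
Qed.

(** Fatou's lemma, giving integrability and the bound together. The weight [a] will be the constant
    1, then the curvature coefficient [bend]. *)
Lemma itg_sqr_limit (a : R -> R) (f : nat -> R -> R) q (B : R) :
  continuous a -> (forall t, 0 <= a t) -> locint q ->
  (forall x, x \notin oitv -> q x = 0) ->
  {ae mu, forall x, x \in oitv -> f j x @[j --> \oo] --> q x} ->
  (forall j, locint (f j)) -> (forall j, locint (fun t => a t * f j t ^+ 2)) ->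
  (forall e : R, 0 < e -> exists J, forall j, (J <= j)%N ->
     itg (fun t => a t * f j t ^+ 2) (-1) 1 <= B + e) ->
  locint (fun t => a t * q t ^+ 2) /\ itg (fun t => a t * q t ^+ 2) (-1) 1 <= B.
Proof.
move=> ca a0 lq q0 fq lf laf HB.
pose D : set R := `]-1, 1[%classic.
have mD : measurable D by exact: measurable_itv.
have ma : measurable_fun [set: R] a by exact: continuous_measurable_fun.
have maq : measurable_fun [set: R] (fun t => a t * q t ^+ 2).
  by apply: measurable_funM => //; apply: measurable_funX; exact: locint_mfun.
have F0 j t : (0 <= (a t * f j t ^+ 2)%:E)%E by rewrite lee_fin mulr_ge0// sqr_ge0.
have mF j : measurable_fun D (fun t => (a t * f j t ^+ 2)%:E).
  by apply/measurable_EFinP/measurable_funTS; exact: locint_mfun.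
have le : (\int[mu]_(t in D) (a t * q t ^+ 2)%:E <= B%:E)%E.
  apply: (@le_trans _ _ (\int[mu]_(t in D) limn_einf (fun j => (a t * f j t ^+ 2)%:E))%E).
    apply: ae_ge0_le_integral => //.
    - by move=> t _; rewrite lee_fin mulr_ge0// sqr_ge0.
    - by apply/measurable_EFinP/measurable_funTS.
    - move=> t _; rewrite limn_einf_lim; apply: lime_ge; first exact: is_cvg_einfs.
      by apply: nearW => n; apply: le_ereal_inf_tmp => _ [k _ <-].
    - rewrite (_ : (fun x => _) = (fun x => - limn_esup (fun j => (- (a x * f j x ^+ 2))%:E))%E).
        apply: measurableT_comp => //; apply: measurable_fun_limn_esup => j.
        by apply/measurable_EFinP/measurable_funTS; exact: locint_mfun (locintN (laf j)).
      apply/funext => x; rewrite -limn_einfN; congr limn_einf; apply/funext => j /=.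
      by rewrite opprK.
    - apply: (aeS _ fq) => t H tD.
      have ft := H (mem_set tD).
      have /cvg_limn_einf_sup[-> _] // : (a t * f j t ^+ 2)%:E @[j --> \oo] --> (a t * q t ^+ 2)%:E.
      apply/cvg_EFin; first exact: nearW.
      by apply: cvgM; [exact: cvg_cst|apply: cvgM].
  apply: (le_trans (fatou mu mD mF (fun n x _ => F0 n x))).
  apply/lee_addgt0Pr => e e0.
  have [J HJ] := HB _ e0.
  rewrite limn_einf_lim; apply: lime_le; first exact: is_cvg_einfs.
  (* The lower limit is a limit of infima over tails. The index max (n, J) lies in the tail from [n]
     and in the range where the bound holds. *)
  apply: nearW => n; apply: (@le_trans _ _ (\int[mu]_(t in D) (a t * f (maxn n J) t ^+ 2)%:E)%E).
    by apply: ereal_inf_lbound; exists (maxn n J) => //=; rewrite leq_maxl.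
  by rewrite -itg_oo// -EFinD lee_fin HJ// leq_maxr.
have laq : locint (fun t => a t * q t ^+ 2).
  have -> : (fun t => a t * q t ^+ 2) = (fun t => a t * q t ^+ 2) \_ `]-1, 1[.
    apply/funext => t; rewrite /patch; case: ifPn => // to.
    by rewrite q0 ?expr0n ?mulr0.
  apply: locint_restrict; apply/integrableP; split.
    by apply/measurable_EFinP/measurable_funTS.
  apply: le_lt_trans (ltry B); apply: le_trans le.
  rewrite le_eqVlt; apply/orP; left; apply/eqP; apply: eq_integral => t _.
  by rewrite gee0_abs// lee_fin mulr_ge0// sqr_ge0.
by split => //; rewrite -lee_fin itg_oo.
Qed.

End L2Limit.

(** * Dyadic step functions of difference quotients *)

Section Dyadic.
Context {R : realType}.
Local Notation mu := (@lebesgue_measure R).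
Implicit Types (p q f g h : R -> R) (i j k l : nat).

Definition mesh k : R := 2 / 2 ^+ k.
Definition node k i : R := -1 + mesh k * i%:R.

Lemma mesh_gt0 k : 0 < mesh k.
Proof. by rewrite divr_gt0// exprn_gt0. Qed.

Lemma node0 k : node k 0 = -1.
Proof. by rewrite /node mulr0 addr0. Qed.

Lemma node_last k : node k (2 ^ k) = 1.
Proof.
rewrite /node /mesh natrX; field.
by rewrite expf_eq0 pnatr_eq0 andbF.
Qed.

Lemma nodeB k i : node k i.+1 - node k i = mesh k.
Proof. by rewrite /node -natr1; ring. Qed.

Lemma node_le k i j : (i <= j)%N -> node k i <= node k j.
Proof. by move=> ij; rewrite lerD2l ler_wpM2l ?ler_nat// ltW// mesh_gt0. Qed.

Lemma node_leS k i : node k i <= node k i.+1.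
Proof. exact: node_le. Qed.

Lemma node_ge k i : -1 <= node k i.
Proof. by rewrite -(node0 k) node_le. Qed.

Lemma node_refine k l i : (k <= l)%N -> node k i = node l (i * 2 ^ (l - k)).
Proof.
move=> kl; rewrite /node /mesh natrM natrX; congr (_ + _).
rewrite -{1}(subnK kl) exprD; field.
by rewrite !expf_eq0 pnatr_eq0 !andbF.
Qed.

Lemma node_interval k x : -1 < x -> x <= 1 ->
  exists i, [/\ (i < 2 ^ k)%N, node k i < x & x <= node k i.+1].
Proof.
move=> x1 x2.
have ex : exists i, x <= node k i by exists (2 ^ k)%N; rewrite node_last.
case: (ex_minnP ex) => [[|i] xi mini].
  by move: xi; rewrite node0 leNgt x1.
exists i; split => //; last by rewrite ltNge; apply/negP => /mini; rewrite ltnn.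
by apply: mini; rewrite node_last.
Qed.

Lemma itg_node f k j : locint f ->
  itg f (-1) (node k j) = \sum_(i < j) itg f (node k i) (node k i.+1).
Proof.
move=> lf; elim: j => [|j IHj]; first by rewrite node0 itgxx big_ord0.
by rewrite big_ord_recr/= -IHj -itg_add// ?node_ge ?node_leS.
Qed.

Lemma itg_nodes f k : locint f ->
  itg f (-1) 1 = \sum_(i < 2 ^ k) itg f (node k i) (node k i.+1).
Proof. by move=> lf; rewrite -itg_node// node_last. Qed.

Section Step.
Context (p : R -> R).

Definition slope k i : R := (p (node k i.+1) - p (node k i)) / mesh k.

(** If [p] is a primitive of [q], this is the conditional expectation of [q] on the dyadic cells of
    generation [k]. The cells are half-open like the domain of [itg]. *)
Definition stepf k t : R :=
  \sum_(i < 2 ^ k) slope k i * \1_(`]node k i, node k i.+1]) t.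

Lemma stepfE k i t : (i < 2 ^ k)%N -> node k i < t -> t <= node k i.+1 ->
  stepf k t = slope k i.
Proof.
move=> ik it ti; rewrite /stepf (bigD1 (Ordinal ik))//= big1.
  by rewrite addr0 indicE mem_set ?mulr1//= in_itv/= it ti.
move=> [j jk] /= ji; rewrite indicE memNset ?mulr0//= in_itv/= => /andP[jt tj].
move: ji; rewrite -val_eqE/= => /eqP; apply; apply/eqP; rewrite eqn_leq.
apply/andP; split; rewrite leqNgt; apply/negP => lt.
  by move: (lt_le_trans jt ti); rewrite ltNge (node_le k lt).
by move: (lt_le_trans it tj); rewrite ltNge (node_le k lt).
Qed.

Lemma stepf_bound k t : `|stepf k t| <= \sum_(i < 2 ^ k) `|slope k i|.
Proof.
apply: (le_trans (ler_norm_sum _ _ _)); apply: ler_sum => i _.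
rewrite normrM -[leRHS]mulr1 ler_wpM2l// indicE.
by case: (_ \in _); rewrite ?normr0 ?normr1.
Qed.

Lemma measurable_stepf k : measurable_fun [set: R] (stepf k).
Proof.
by apply: measurable_sum => i; exact: measurable_funM.
Qed.

Lemma locint_stepf k : locint (stepf k).
Proof.
apply: (locint_le (measurable_stepf k) (locint_cst (\sum_(i < 2 ^ k) `|slope k i|))).
exact: stepf_bound.
Qed.

Lemma locint_stepfM k f : locint f -> locint (fun t => stepf k t * f t).
Proof. by move=> lf; apply: (locint_bndM (measurable_stepf k) lf (@stepf_bound k)). Qed.

Lemma locint_stepf_sqr k : locint (fun t => stepf k t ^+ 2).
Proof. exact: (locint_stepfM k (locint_stepf k)). Qed.

Lemma itg_stepfM k i f : (i < 2 ^ k)%N -> locint f ->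
  itg (fun t => stepf k t * f t) (node k i) (node k i.+1) =
  slope k i * itg f (node k i) (node k i.+1).
Proof.
move=> ik lf; rewrite -itgZ//; apply: eq_itg => t it ti.
by rewrite (stepfE ik it ti).
Qed.

Lemma itg_stepf k i : (i < 2 ^ k)%N ->
  itg (stepf k) (node k i) (node k i.+1) = p (node k i.+1) - p (node k i).
Proof.
move=> ik; have := itg_stepfM ik (locint_cst 1).
rewrite itg_cst ?node_leS// nodeB mul1r /slope divfK ?gt_eqF ?mesh_gt0// => <-.
by apply: eq_itg => t _ _; rewrite mulr1.
Qed.

Lemma itg_stepf_node k j : (j <= 2 ^ k)%N ->
  itg (stepf k) (-1) (node k j) = p (node k j) - p (-1).
Proof.
move=> jk; rewrite itg_node; last exact: locint_stepf.
transitivity (\sum_(0 <= i < j) (p (node k i.+1) - p (node k i))).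
  rewrite big_mkord; apply: eq_bigr => i _.
  by rewrite itg_stepf// (leq_trans (ltn_ord i)).
by rewrite telescope_sumr// node0.
Qed.

(** The martingale property: coarse nodes are also fine nodes, and between its own nodes the fine
    step function integrates exactly to the increment of [p]. *)
Lemma itg_stepf_refine k l i : (k <= l)%N -> (i < 2 ^ k)%N ->
  itg (stepf l) (node k i) (node k i.+1) = p (node k i.+1) - p (node k i).
Proof.
move=> kl ik.
have fine_node j : (j <= 2 ^ k)%N -> itg (stepf l) (-1) (node k j) = p (node k j) - p (-1).
  move=> jk; rewrite (node_refine j kl) itg_stepf_node//.
  by rewrite -{2}(subnKC kl) expnD leq_mul2r jk orbT.
have := itg_add (locint_stepf l) (node_ge k i) (node_leS k i).
rewrite !fine_node//; last exact: ltnW.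
lra.
Qed.

Definition quotient_energy k : R := itg (fun t => stepf k t ^+ 2) (-1) 1.

Lemma quotient_energyE k : quotient_energy k =
  \sum_(i < 2 ^ k) (p (node k i.+1) - p (node k i)) ^+ 2 / mesh k.
Proof.
rewrite /quotient_energy (itg_nodes k (locint_stepf_sqr k)); apply: eq_bigr => i _.
rewrite (itg_stepfM _ (locint_stepf k))// itg_stepf// /slope.
by rewrite expr2 mulrAC.
Qed.

(* The stepf k form a martingale: they are conditional expectations of each
   other, so that their increments are orthogonal. *)
Lemma itg_stepf_dist k l : (k <= l)%N ->
  itg (fun t => (stepf l t - stepf k t) ^+ 2) (-1) 1 = quotient_energy l - quotient_energy k.
Proof.
move=> kl.
have cross : itg (fun t => stepf k t * stepf l t) (-1) 1 = quotient_energy k.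
  rewrite quotient_energyE (itg_nodes k); last exact: locint_stepfM (locint_stepf l).
  apply: eq_bigr => i _.
  rewrite (itg_stepfM _ (locint_stepf l))// itg_stepf_refine// /slope.
  by rewrite expr2 mulrAC.
have l1 := locint_stepf_sqr l; have l2 := locint_stepf_sqr k.
have l3 := locint_stepfM k (locint_stepf l).
rewrite (@eq_itg _ _
  (fun t => stepf l t ^+ 2 - 2 * (stepf k t * stepf l t) + stepf k t ^+ 2)); last first.
  by move=> t _ _; ring.
rewrite itgD//; last by apply: locintB => //; exact: locintZ.
rewrite itgB//; last exact: locintZ.
rewrite itgZ// cross /quotient_energy; ring.
Qed.

(** At the nodes the integral is exact; inside a cell, [p] and its chord each deviate by at most [d]
    from the value at the left node. *)
Lemma itg_stepf_near k x d : -1 <= x -> x <= 1 -> 0 <= d ->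
  (forall s t, `|t - s| <= mesh k -> `|p t - p s| <= d) ->
  `|itg (stepf k) (-1) x - (p x - p (-1))| <= 2 * d.
Proof.
move=> x1 x2 d0 osc; move: x1; rewrite le_eqVlt => /predU1P[<-|x1].
  by rewrite itgxx !subrr normr0 mulr_ge0.
have [i [ik ix xi]] := node_interval k x1 x2.
rewrite (itg_add (locint_stepf k) (node_ge k i) (ltW ix)) itg_stepf_node; last exact: ltnW.
rewrite (@eq_itg _ (stepf k) (fun=> slope k i)); last first.
  by move=> t it tx; rewrite (stepfE ik)// (le_trans tx).
rewrite itg_cst ?(ltW ix)//.
rewrite (_ : _ - _ = (p (node k i) - p x) + slope k i * (x - node k i)); last by ring.
have xim : x - node k i <= mesh k by rewrite -(nodeB k i) lerD2r.
apply: (le_trans (ler_normD _ _)); rewrite mulr_natl mulr2n; apply: lerD.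
  by apply: osc; rewrite distrC ger0_norm// subr_ge0 ltW.
rewrite /slope normrM normrM normfV (gtr0_norm (mesh_gt0 k)) mulrAC ler_pdivrMr ?mesh_gt0//.
rewrite ler_pM//; last by rewrite ger0_norm// subr_ge0 ltW.
by apply: osc; rewrite nodeB gtr0_norm ?mesh_gt0.
Qed.

Lemma mesh_cvg0 : mesh k @[k --> \oo] --> 0.
Proof.
rewrite -(mulr0 2); apply: cvgM; first exact: cvg_cst.
have -> : (fun k => (2 ^+ k)^-1 : R) = (fun k => 2^-1 ^+ k).
  by apply/funext => k; rewrite exprVn.
by apply: cvg_expr; rewrite ger0_norm ?invr_ge0// invf_lt1// ltr1n.
Qed.

(** [quotient_energy] is nondecreasing in [k] and bounded by [K], so along suitable indices it comes
    within 4^-j of its supremum. Squared distances between step functions are differences of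
    quotient energies, hence the selected ones form a rapidly converging Cauchy sequence. *)
Lemma derivative_of_quotients K : ucont p ->
  (forall k, \sum_(i < 2 ^ k) (p (node k i.+1) - p (node k i)) ^+ 2 / mesh k <= K) ->
  exists q (s : nat -> nat), [/\ locint q, forall x, x \notin oitv -> q x = 0,
    forall j, (j <= s j)%N,
    {ae mu, forall x, x \in oitv -> stepf (s j) x @[j --> \oo] --> q x} &
    forall x, -1 <= x -> x <= 1 -> p x - p (-1) = itg q (-1) x].
Proof.
move=> up EK.
have Ele k : quotient_energy k <= K by rewrite quotient_energyE.
have Emono k l : (k <= l)%N -> quotient_energy k <= quotient_energy l.
  move=> kl; rewrite -subr_ge0 -itg_stepf_dist//.
  by apply: itg_ge0 => t; exact: sqr_ge0.
pose S := [set quotient_energy k | k in [set: nat]].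
have supS : has_sup S.
  by split; [exists (quotient_energy 0), 0%N|exists K => _ [k _ <-]].
have ex j : exists k, sup S - 4 ^- j < quotient_energy k.
  have /(sup_adherent) := supS; move=> /(_ (4 ^- j)) [].
    by rewrite invr_gt0 exprn_gt0.
  by move=> _ [k _ <-] h; exists k.
have [kk Hk] := choice ex.
(* The sum makes [s] nondecreasing and at least [kk j]; the summand [j] drives it to infinity. *)
pose s j := (j + \sum_(i < j.+1) kk i)%N.
have sj j : (j <= s j)%N by rewrite leq_addr.
have kks j : (kk j <= s j)%N by rewrite /s big_ord_recr/= addnA leq_addl.
have sS j : (s j <= s j.+1)%N.
  by rewrite /s [X in (_ <= _ + X)%N]big_ord_recr/= leq_add// leq_addr.
have Esup k : quotient_energy k <= sup S by apply: (ub_le_sup supS.2); exists k.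
have [|||q [lq q0 fq cq]] := @L2_cauchy_limit R (fun j => stepf (s j)).
- by move=> j; exact: locint_stepf.
- move=> j; have lm := measurable_funB (measurable_stepf (s j.+1)) (measurable_stepf (s j)).
  apply: (@locint_bndM _ _ _ (\sum_(i < 2 ^ (s j.+1)) `|slope (s j.+1) i| +
     \sum_(i < 2 ^ (s j)) `|slope (s j) i|)) => //.
    by apply: locintB; exact: locint_stepf.
  move=> x; apply: (le_trans (ler_normB _ _)).
  by apply: lerD; exact: stepf_bound.
- move=> j; rewrite itg_stepf_dist//.
  have := Esup (s j.+1); have := Hk j; have := Emono _ _ (kks j); lra.
exists q, s; split => // x x1 x2.
apply/esym; apply: (cvg_unique _ (cq x x1 x2)) => //.
apply/cvgrPdist_le => e e0.
have e20 : 0 < e / 2 by rewrite divr_gt0.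
have [d d0 Hd] := up _ e20.
have /cvgrPdist_lt/(_ _ d0)[N _ HN] := mesh_cvg0.
exists N => // j /= Nj; rewrite distrC.
apply: (le_trans (itg_stepf_near x1 x2 (ltW e20) _)); last by lra.
move=> a b ab; apply: Hd; apply: (le_lt_trans ab).
have := HN (s j) (leq_trans Nj (sj j)); rewrite sub0r normrN gtr0_norm//.
exact: mesh_gt0.
Qed.

End Step.
End Dyadic.

(** * Compactness and lower semicontinuity *)

Section Compactness.
Context {R : realType}.
Local Notation mu := (@lebesgue_measure R).
Implicit Types (alpha : R) (v p q w f g : R -> R).

(** The image of an ultrafilter is an ultrafilter, so it converges in a compact interval. Used at
    every point with the same [U], this stands in for a diagonal extraction of subsequences. *)
Lemma ultra_cvg_bounded (U : set_system nat) (f : nat -> R) (M : R) :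
  UltraFilter U -> (forall n, `|f n| <= M) -> exists l : R, f @ U --> l.
Proof.
move=> UU fM.
have PU : ProperFilter U by exact: ultra_proper.
have FU : UltraFilter (f @ U).
  split; first exact: fmap_proper_filter.
  move=> G GP sub; apply/seteqP; split => // A GA.
  have [//|UA] := in_ultra_setVsetC (f @^-1` A) UU.
  have GcA : G (~` A) by apply: sub.
  by have := filterI GA GcA; rewrite setICr => G0; case: (@filter_not_empty _ G GP); exact: G0.
have cM : compact (`[- M, M]%classic : set R) by exact: segment_compact.
move: cM; rewrite compact_ultra => /(_ (f @ U) FU) [].
  have H : U (f @^-1` `[- M, M]%classic).
    by apply: filterE => n; rewrite /= in_itv/= -ler_norml; exact: fM.
  exact: H.
by move=> l [_ fl]; exists l.
Qed.

Lemma cvg_ord_sum (U : set_system nat) n (f : nat -> nat -> R) (l : nat -> R) :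
  Filter U -> (forall i, f i @ U --> l i) ->
  (fun m => \sum_(i < n) f i m) @ U --> \sum_(i < n) l i.
Proof.
by move=> FU fl; apply: (@cvg_big R _ +%R 0) => //; exact: add_continuous.
Qed.

Section Bounded.
Context (C c M K : R).

(** Each clause is a closed condition on the values at one or two points, so it survives pointwise
    limits; the bound on the integral of q^2 appears only through the Hölder estimate for [p]. *)
Record bounded_profile v p : Prop := BoundedProfile {
  bp_p : forall x, `|p x| <= C;
  bp_v_ge : forall x, c <= v x;
  bp_v_le : forall x, v x <= M;
  bp_v_lip : forall x y, `|v y - v x| <= C * `|y - x|;
  bp_p_hoelder : forall x y, (p y - p x) ^+ 2 <= K * `|y - x| }.

Hypothesis c0 : 0 < c.

Definition bend v p t : R := v t * (arcl (p t))^-1 ^+ 5.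
Definition inverse_area v p t : R := (v t)^-1 * (arcl (p t))^-1.

Lemma densityE v p q t :
  density (v t) (p t) (q t) = bend v p t * q t ^+ 2 + inverse_area v p t.
Proof. by rewrite /density /bend /inverse_area mulrAC. Qed.

(** The radius [d] is common to all bounded profiles, so the errors of the Riemann sums are uniform
    along the sequence. *)
Lemma coefficient_modulus (e : R) : 0 < e -> exists2 d : R, 0 < d & forall v p,
  bounded_profile v p -> forall s t, `|t - s| < d ->
  `|bend v p t - bend v p s| <= e /\ `|inverse_area v p t - inverse_area v p s| <= e.
Proof.
move=> e0.
(* [A] collects the Lipschitz factors: 1 and 5 |M| for [bend], c^-2 and c^-1 for [inverse_area]. *)
pose L := `|C| + 1; pose A := 1 + `|M| * 5 + c^-1 ^+ 2 + c^-1.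
have L0 : 0 < L by rewrite ltr_wpDl.
have ci0 : 0 < c^-1 by rewrite invr_gt0.
have A0 : 0 < A.
  by rewrite /A ltr_pwDr// addr_ge0 ?sqr_ge0// addr_ge0// mulr_ge0.
pose eta := e / A; have eta0 : 0 < eta by rewrite divr_gt0.
have [d d0 Hd] := hoelder_modulus K eta0.
have d'0 : 0 < eta / L by rewrite divr_gt0.
exists (Num.min d (eta / L)); first by rewrite lt_min d0.
move=> v p H s t; rewrite lt_min => /andP[std std'].
have dp : `|p t - p s| <= eta by exact: Hd (bp_p_hoelder H) _ _ std.
have dv : `|v t - v s| <= eta.
  apply: (le_trans (bp_v_lip H _ _)); rewrite ltr_pdivlMr// in std'.
  apply: le_trans (ltW std'); rewrite mulrC ler_wpM2l//.
  by rewrite (le_trans (ler_norm _))// lerDl.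
have v0 x : 0 < v x := lt_le_trans c0 (bp_v_ge H x).
have vM x : `|v x| <= `|M|.
  by rewrite gtr0_norm// (le_trans (bp_v_le H x))// ler_norm.
have vi x : `|(v x)^-1| <= c^-1.
  by rewrite gtr0_norm ?invr_gt0// lef_pV2 ?posrE// (bp_v_ge H).
have ar n x : `|(arcl (p x))^-1 ^+ n| <= 1.
  rewrite ger0_norm ?exprn_ge0 ?(ltW (arclV_gt0 _))//.
  by rewrite exprn_ile1 ?arclV_le1 ?(ltW (arclV_gt0 _)).
have eE : e = A * eta by rewrite /eta mulrCA divff ?mulr1// gt_eqF.
have eS : e = eta + `|M| * 5 * eta + c^-1 ^+ 2 * eta + c^-1 * eta.
  by rewrite [LHS]eE /A; ring.
have parts : 0 <= `|M| * 5 * eta /\ 0 <= c^-1 ^+ 2 * eta /\ 0 <= c^-1 * eta.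
  have eta0' := ltW eta0; split; first by rewrite mulr_ge0// mulr_ge0.
  by split; rewrite mulr_ge0 ?sqr_ge0 ?(ltW ci0).
have [M0 [c20 c10]] := parts.
split.
- rewrite (_ : _ - _ = (v t - v s) * (arcl (p t))^-1 ^+ 5 +
    v s * ((arcl (p t))^-1 ^+ 5 - (arcl (p s))^-1 ^+ 5)); last by rewrite /bend; ring.
  apply: (le_trans (ler_normD _ _)); rewrite (normrM (v t - v s)) (normrM (v s)).
  have h1 : `|v t - v s| * `|(arcl (p t))^-1 ^+ 5| <= eta.
    by rewrite -[leRHS]mulr1 ler_pM.
  have h2 : `|v s| * `|(arcl (p t))^-1 ^+ 5 - (arcl (p s))^-1 ^+ 5| <= `|M| * 5 * eta.
    rewrite -mulrA ler_pM//; apply: (le_trans (arclVX_lip 5 _ _)).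
    by rewrite ler_wpM2l.
  apply: (le_trans (lerD h1 h2)); rewrite eS; lra.
- rewrite (_ : _ - _ = ((v t)^-1 - (v s)^-1) * (arcl (p t))^-1 +
    (v s)^-1 * ((arcl (p t))^-1 - (arcl (p s))^-1)); last by rewrite /inverse_area; ring.
  apply: (le_trans (ler_normD _ _)); rewrite (normrM (_ - _)) (normrM (v s)^-1).
  have h1 : `|(v t)^-1 - (v s)^-1| * `|(arcl (p t))^-1| <= c^-1 ^+ 2 * eta.
    rewrite -[leRHS]mulr1 ler_pM//; last exact: (ar 1%N).
    apply: (le_trans (inv_lip c0 (bp_v_ge H _) (bp_v_ge H _))).
    by rewrite ler_wpM2l// sqr_ge0.
  have h2 : `|(v s)^-1| * `|(arcl (p t))^-1 - (arcl (p s))^-1| <= c^-1 * eta.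
    by rewrite ler_pM// (le_trans (arclV_lip _ _)).
  apply: (le_trans (lerD h1 h2)); rewrite eS; lra.
Qed.

Lemma bend_ge0 v p t : bounded_profile v p -> 0 <= bend v p t.
Proof.
move=> H; rewrite mulr_ge0 ?exprn_ge0 ?(ltW (arclV_gt0 _))//.
exact: le_trans (ltW c0) (bp_v_ge H t).
Qed.

Lemma coefficient_continuous v p : bounded_profile v p ->
  continuous (bend v p) /\ continuous (inverse_area v p).
Proof.
move=> H; split; apply: ucont_continuous => e /coefficient_modulus[d d0 Hd].
  by exists d => // x y xy; exact: (Hd _ _ H x y xy).1.
by exists d => // x y xy; exact: (Hd _ _ H x y xy).2.
Qed.

(* It only involves the values of v and p at the nodes, hence it is continuous
   under pointwise convergence. *)
Definition riemann_energy k v p : R := \sum_(i < 2 ^ k)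
  (bend v p (node k i) * ((p (node k i.+1) - p (node k i)) ^+ 2 / mesh k)
   + inverse_area v p (node k i) * mesh k).

Lemma node_dist k i (t : R) : node k i < t -> t <= node k i.+1 -> `|t - node k i| <= mesh k.
Proof.
move=> it ti; rewrite ger0_norm ?subr_ge0 ?(ltW it)//.
by rewrite -(nodeB k i) lerD2r.
Qed.

Lemma quotient_le p q k i : prim p q -> locint (fun t => q t ^+ 2) ->
  (p (node k i.+1) - p (node k i)) ^+ 2 / mesh k <=
    itg (fun t => q t ^+ 2) (node k i) (node k i.+1).
Proof.
move=> [lq pq] lq2; rewrite pq ?node_leS// ler_pdivrMr ?mesh_gt0// mulrC.
rewrite -(nodeB k i); apply: itg_cauchy_schwarz => //; last exact: node_leS.
exact: locint_mfun.
Qed.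

Lemma sum_quotient_le p q k : prim p q -> locint (fun t => q t ^+ 2) ->
  \sum_(i < 2 ^ k) (p (node k i.+1) - p (node k i)) ^+ 2 / mesh k <=
    itg (fun t => q t ^+ 2) (-1) 1.
Proof.
by move=> pq lq2; rewrite (itg_nodes k lq2); apply: ler_sum => i _; exact: quotient_le.
Qed.

(** Freezing the coefficients at the left node costs [e] times the integral of q^2 + 1, whence the
    2, the length of [-1, 1]; Cauchy-Schwarz on each cell then bounds the difference quotients. *)
Lemma riemann_energy_le v p q k (e : R) : prim p q -> locint (fun t => q t ^+ 2) ->
  bounded_profile v p -> 0 <= e ->
  (forall s t, `|t - s| <= mesh k -> `|bend v p t - bend v p s| <= e /\
     `|inverse_area v p t - inverse_area v p s| <= e) ->
  riemann_energy k v p <= energy v p q + e * (itg (fun t => q t ^+ 2) (-1) 1 + 2).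
Proof.
move=> pq lq2 H e0 mod.
have [ca cb] := coefficient_continuous H.
have la : locint (fun t => bend v p t * q t ^+ 2) by exact: locint_continuousM.
have lb := locint_continuous cb.
have -> : energy v p q + e * (itg (fun t => q t ^+ 2) (-1) 1 + 2) =
    itg (fun t => (bend v p t * q t ^+ 2 + e * q t ^+ 2) + (inverse_area v p t + e)) (-1) 1.
  rewrite itgD; [|by apply: locintD => //; exact: locintZ|by apply: locintD => //; exact: locint_cst].
  have -> : itg (fun t => bend v p t * q t ^+ 2 + e * q t ^+ 2) (-1) 1 =
      itg (fun t => bend v p t * q t ^+ 2) (-1) 1 + e * itg (fun t => q t ^+ 2) (-1) 1.
    by rewrite itgD// ?itgZ//; exact: locintZ.
  have -> : itg (fun t => inverse_area v p t + e) (-1) 1 = itg (inverse_area v p) (-1) 1 + e * 2.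
    rewrite itgD//; last exact: locint_cst.
    by rewrite itg_cst; [ring|lra].
  rewrite /energy (@eq_itg _ _ (fun t => bend v p t * q t ^+ 2 + inverse_area v p t)); last first.
    by move=> t _ _; rewrite densityE.
  by rewrite itgD//; ring.
have l1 : locint (fun t => bend v p t * q t ^+ 2 + e * q t ^+ 2).
  by apply: locintD => //; exact: locintZ.
have l2 : locint (fun t => inverse_area v p t + e).
  by apply: locintD => //; exact: locint_cst.
rewrite (itg_nodes k (locintD l1 l2)); apply: ler_sum => i _.
rewrite itgD//; apply: lerD.
  apply: (le_trans (ler_wpM2l (bend_ge0 _ H) (quotient_le k i pq lq2))).
  rewrite -itgZ//; apply: itg_le => //; first exact: locintZ.
  move=> t it ti; rewrite -mulrDl ler_wpM2r ?sqr_ge0//.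
  by have [+ _] := mod _ _ (node_dist it ti); rewrite ler_norml => /andP[]; lra.
rewrite -{1}(nodeB k i) -itg_cst ?node_leS//; apply: itg_le => //; first exact: locint_cst.
move=> t it ti.
by have [_ +] := mod _ _ (node_dist it ti); rewrite ler_norml => /andP[]; lra.
Qed.

(** The reverse comparison, with the step function in place of [q]: it is constant on each cell, so
    Cauchy-Schwarz becomes an equality there. Together with [riemann_energy_le] it carries the
    energy bound from the sequence to the limit. *)
Lemma stepf_energy_le v p k (e : R) : bounded_profile v p -> 0 <= e ->
  (forall s t, `|t - s| <= mesh k -> `|bend v p t - bend v p s| <= e /\
     `|inverse_area v p t - inverse_area v p s| <= e) ->
  itg (fun t => bend v p t * stepf p k t ^+ 2) (-1) 1 + itg (inverse_area v p) (-1) 1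
    <= riemann_energy k v p + e * (quotient_energy p k + 2).
Proof.
move=> H e0 mod.
have [ca cb] := coefficient_continuous H.
have ls := locint_stepf_sqr p k.
have la : locint (fun t => bend v p t * stepf p k t ^+ 2) by exact: locint_continuousM.
have lb := locint_continuous cb.
have -> : e * (quotient_energy p k + 2) = \sum_(i < 2 ^ k)
    (e * ((p (node k i.+1) - p (node k i)) ^+ 2 / mesh k) + e * mesh k).
  rewrite big_split/= -mulr_sumr -quotient_energyE mulrDr; congr (_ + _).
  have -> : 2 = \sum_(i < 2 ^ k) mesh k :> R; last by rewrite mulr_sumr.
  have := itg_nodes k (locint_cst (1 : R)); rewrite itg_cst; last by lra.
  rewrite mul1r (_ : 1 - -1 = 2); last by ring.
  by move=> ->; apply: eq_bigr => i _; rewrite itg_cst ?node_leS// nodeB mul1r.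
rewrite /riemann_energy -big_split/= -itgD// (itg_nodes k (locintD la lb)).
apply: ler_sum => i _; rewrite itgD// addrACA -!mulrDl.
have ss : itg (fun t => stepf p k t ^+ 2) (node k i) (node k i.+1) =
    (p (node k i.+1) - p (node k i)) ^+ 2 / mesh k.
  have := itg_stepfM p (ltn_ord i) (locint_stepf p k); rewrite (itg_stepf p (ltn_ord i)).
  rewrite /slope => E.
  by rewrite (_ : (fun t => _) = (fun t => stepf p k t * stepf p k t))// E mulrAC expr2.
apply: lerD.
  rewrite -ss -itgZ//; apply: itg_le => //; first exact: locintZ.
  move=> t it ti; rewrite ler_wpM2r ?sqr_ge0//.
  by have [+ _] := mod _ _ (node_dist it ti); rewrite ler_norml => /andP[]; lra.
rewrite -(nodeB k i) -itg_cst ?node_leS//; apply: itg_le => //; first exact: locint_cst.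
move=> t it ti.
by have [_ +] := mod _ _ (node_dist it ti); rewrite ler_norml => /andP[]; lra.
Qed.

End Bounded.

Lemma profile_bounded alpha C c M K v p q : profile alpha v p q ->
  (forall x, `|p x| <= C) -> (forall x, c <= v x) -> (forall x, v x <= M) ->
  itg (fun t => q t ^+ 2) (-1) 1 <= K -> bounded_profile C c M K v p.
Proof.
move=> H pC cv vM qK; split => //.
- exact: prim_lip (profile_vp H) pC.
- move=> x y; apply: (le_trans (profile_hoelder H x y)).
  by rewrite ler_wpM2r.
Qed.

(* First-order Taylor remainders detect primitives and pass to pointwise limits. *)
Lemma prim_taylor v p (e d : R) : prim v p ->
  (forall x y, `|y - x| < d -> `|p y - p x| <= e) ->
  forall x y, x <= y -> y - x < d -> `|v y - v x - p x * (y - x)| <= e * (y - x).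
Proof.
move=> [lp vp] mod x y xy yxd.
have lpx : locint (fun t => p t - p x) by apply: locintB => //; exact: locint_cst.
rewrite vp// -itg_cst// -itgB//; last exact: locint_cst.
rewrite -(itg_cst e xy); apply: (le_trans (itg_norm _ _ lpx)).
apply: itg_le; [exact: locint_norm|exact: locint_cst|move=> t xt ty].
apply: mod; rewrite ger0_norm ?subr_ge0 ?(ltW xt)//.
by apply: le_lt_trans yxd; rewrite lerD2r.
Qed.

Lemma taylor_prim v p : locint p -> ucont p ->
  (forall e : R, 0 < e -> exists2 d : R, 0 < d & forall x y, x <= y -> y - x < d ->
     `|v y - v x - p x * (y - x)| <= e * (y - x)) ->
  prim v p.
Proof.
move=> lp up H; split => // a b ab.
pose U t := v t - itg p a t.
suff : U b = U a by rewrite /U itgxx subr0; lra.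
apply: (@sewing _ U id a b ab) => e e0.
have e20 : 0 < e / 2 by rewrite divr_gt0.
have [d d0 Hd] := H _ e20; have [d' d'0 Hd'] := up _ e20.
exists (Num.min d d'); first by rewrite lt_min d0.
move=> x y ax xy yb; rewrite lt_min => /andP[xyd xyd'].
have lpx : locint (fun t => p t - p x) by apply: locintB => //; exact: locint_cst.
rewrite (_ : U y - U x = (v y - v x - p x * (y - x)) - itg (fun t => p t - p x) x y); last first.
  rewrite /U (itg_add lp ax xy) itgB//; last exact: locint_cst.
  by rewrite itg_cst//; ring.
apply: (le_trans (ler_normB _ _)); rewrite [X in _ <= X * _]splitr mulrDl.
apply: lerD; first exact: Hd.
rewrite -(itg_cst _ xy); apply: (le_trans (itg_norm _ _ lpx)).
apply: itg_le; [exact: locint_norm|exact: locint_cst|move=> t xt ty].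
apply: Hd'; rewrite ger0_norm ?subr_ge0 ?(ltW xt)//.
by apply: le_lt_trans xyd'; rewrite lerD2r.
Qed.

Section Limit.
Context (alpha C c M K B : R) (v p q : nat -> R -> R).
Hypothesis c0 : 0 < c.
Hypothesis Hprof : forall n, profile alpha (v n) (p n) (q n).
Hypothesis Hbound : forall n, bounded_profile C c M K (v n) (p n).
Hypothesis HqK : forall n, itg (fun t => q n t ^+ 2) (-1) 1 <= K.
Hypothesis Henergy : forall e : R, 0 < e ->
  \forall n \near \oo, energy (v n) (p n) (q n) <= B + e.

(** The last clause of the conclusion is what lets the obstacle constraint pass to the limit. *)
Lemma minimizing_limit : exists v' p' q',
  [/\ profile alpha v' p' q', energy v' p' q' <= B &
    forall x y, (forall n, v n x <= y) -> v' x <= y].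
Proof.
(* [U] refines convergence to infinity, so whatever holds for all large [n], such as [Henergy],
   holds along [U]. *)
have [U [UU ooU]] := @ultraFilterLemma nat \oo _.
have PU : ProperFilter U by exact: ultra_proper.
have exp x : exists l : R, (fun n => p n x) @ U --> l.
  by apply: (@ultra_cvg_bounded U _ C UU) => n; exact: (bp_p (Hbound n)).
have exv x : exists l : R, (fun n => v n x) @ U --> l.
  apply: (@ultra_cvg_bounded U _ M UU) => n.
  by rewrite gtr0_norm ?(bp_v_le (Hbound n))// (profile_gt0 (Hprof n)).
have [p' cp] := choice exp; have [v' cv] := choice exv.
have lim_le (f : nat -> R) (l y : R) : f @ U --> l -> (forall n, f n <= y) -> l <= y.
  move=> fl fy; apply: (ler_cvg_to fl (cvg_cst y)); exact: nearW.
have lim_ge (f : nat -> R) (l y : R) : f @ U --> l -> (forall n, y <= f n) -> y <= l.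
  move=> fl fy; apply: (ler_cvg_to (cvg_cst y) fl); exact: nearW.
have lim_norm (f : nat -> R) (l y : R) : f @ U --> l -> (forall n, `|f n| <= y) -> `|l| <= y.
  by move=> fl fy; apply: (lim_le _ _ _ (cvg_norm fl)).
have lim_eq (f : nat -> R) (l y : R) : f @ U --> l -> (forall n, f n = y) -> l = y.
  move=> fl fy; apply: (cvg_unique _ fl) => //.
  by rewrite (_ : f = fun=> y); [exact: cvg_cst|exact/funext].
have cpB x y : (fun n => p n y - p n x) @ U --> p' y - p' x by apply: cvgB.
have cpX x y : (fun n => (p n y - p n x) ^+ 2) @ U --> (p' y - p' x) ^+ 2.
  by apply: cvgM; exact: cpB.
have cvB x y : (fun n => v n y - v n x) @ U --> v' y - v' x by apply: cvgB.
have Hb : bounded_profile C c M K v' p'.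
  split.
  - by move=> x; apply: (lim_norm _ _ _ (cp x)) => n; exact: (bp_p (Hbound n)).
  - by move=> x; apply: (lim_ge _ _ _ (cv x)) => n; exact: (bp_v_ge (Hbound n)).
  - by move=> x; apply: (lim_le _ _ _ (cv x)) => n; exact: (bp_v_le (Hbound n)).
  - move=> x y; apply: (lim_norm _ _ _ (cvB x y)) => n.
    exact: (bp_v_lip (Hbound n)).
  - by move=> x y; apply: (lim_le _ _ _ (cpX x y)) => n; exact: (bp_p_hoelder (Hbound n)).
have up : ucont p' := hoelder_ucont (bp_p_hoelder Hb).
have lp : locint p' := locint_continuous (ucont_continuous up).
have vp : prim v' p'.
  apply: taylor_prim => // e e0; have [d d0 Hd] := hoelder_modulus K e0.
  exists d => // x y xy yxd.
  have cc : (fun n => v n y - v n x - p n x * (y - x)) @ U --> v' y - v' x - p' x * (y - x).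
    by apply: cvgB; [exact: cvB|apply: cvgM; [exact: cp|exact: cvg_cst]].
  apply: (lim_norm _ _ _ cc) => n.
  apply: (prim_taylor (profile_vp (Hprof n)) _ xy yxd).
  exact: Hd (bp_p_hoelder (Hbound n)).
have quot k : \sum_(i < 2 ^ k) (p' (node k i.+1) - p' (node k i)) ^+ 2 / mesh k <= K.
  have cq i : (fun n => (p n (node k i.+1) - p n (node k i)) ^+ 2 / mesh k) @ U -->
      (p' (node k i.+1) - p' (node k i)) ^+ 2 / mesh k.
    by apply: cvgM; [exact: cpX|exact: cvg_cst].
  apply: (lim_le _ _ _ (cvg_ord_sum (n := 2 ^ k) _ cq)) => n.
  apply: le_trans (HqK n); apply: sum_quotient_le; first exact: (profile_pq (Hprof n)).
  exact: (profile_q2 (Hprof n)).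
have p0 x : x \notin oitv -> p' x = 0.
  by move=> xo; apply: (lim_eq _ _ _ (cp x)) => n; exact: (profile_p0 (Hprof n)).
have [q' [s [lq q0 sj fq pq0]]] := derivative_of_quotients up quot.
have pm1 : p' (-1) = 0 by apply: p0; rewrite in_oitv ltxx.
have pq : prim p' q'.
  have E x : p' x = itg q' (-1) x.
    have [x1|x1] := leP x (-1).
      rewrite itg_itv0 ?x1// p0// in_oitv negb_and -!leNgt x1//.
    have [x2|x2] := leP x 1; first by rewrite -pq0 ?pm1 ?subr0// ltW.
    have m1 : (-1 : R) <= 1 by lra.
    rewrite (itg_add lq m1 (ltW x2)) -pq0// (itg_itv0 (x := 1)) ?lexx ?orbT//.
    by rewrite pm1 !p0 ?subr0 ?addr0// in_oitv negb_and -!leNgt ?lexx ?(ltW x2) ?orbT.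
  have -> : p' = (fun x => itg q' (-1) x) by apply/funext.
  exact: prim_itg.
have mesh_lt (d : R) : 0 < d -> exists N, forall k, (N <= k)%N -> mesh k < d.
  move=> d0; have /cvgrPdist_lt/(_ _ d0)[N _ HN] := @mesh_cvg0 R.
  exists N => k Nk; have := HN k Nk.
  by rewrite sub0r normrN gtr0_norm// mesh_gt0.
have Kge0 : 0 <= K.
  apply: le_trans (quot 0); apply: sumr_ge0 => i _.
  by rewrite divr_ge0 ?sqr_ge0// ltW// mesh_gt0.
have [ca cb] := coefficient_continuous c0 Hb.
have energy_le (e : R) : 0 < e -> exists N, forall k, (N <= k)%N ->
    itg (fun t => bend v' p' t * stepf p' k t ^+ 2) (-1) 1 + itg (inverse_area v' p') (-1) 1 <= B + e.
  move=> e0.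
  (* The two comparisons with Riemann sums cost eta (K + 2) each, and the energies of the sequence
     may exceed [B] by eta. *)
  have D0 : 0 < 2 * (K + 2) + 1 by rewrite ltr_wpDl// mulr_ge0// addr_ge0.
  pose eta := e / (2 * (K + 2) + 1); have eta0 : 0 < eta by rewrite divr_gt0.
  have eE : e = eta * (K + 2) + eta * (K + 2) + eta.
    rewrite /eta -{1}(divfK (lt0r_neq0 D0) e); ring.
  have [d d0 Hd] := coefficient_modulus C M K c0 eta0.
  have [N HN] := mesh_lt _ d0.
  exists N => k Nk.
  have mod w r : bounded_profile C c M K w r -> forall s t, `|t - s| <= mesh k ->
      `|bend w r t - bend w r s| <= eta /\ `|inverse_area w r t - inverse_area w r s| <= eta.
    by move=> Hw s' t st; apply: Hd => //; exact: le_lt_trans st (HN k Nk).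
  apply: (le_trans (stepf_energy_le c0 Hb (ltW eta0) (mod _ _ Hb))).
  have h1 : eta * (quotient_energy p' k + 2) <= eta * (K + 2).
    by rewrite ler_wpM2l ?(ltW eta0)// lerD2r quotient_energyE.
  suff h2 : riemann_energy k v' p' <= B + eta + eta * (K + 2) by lra.
  have cvia x : (fun n => (v n x)^-1 * (arcl (p n x))^-1) @ U --> (v' x)^-1 * (arcl (p' x))^-1.
    apply: cvgM; apply: cvgV.
    - by rewrite gt_eqF// (lt_le_trans c0)// (bp_v_ge Hb).
    - exact: cv.
    - exact: arcl_neq0.
    - exact: (cvg_comp _ _ (cp x) (@arcl_continuous R (p' x))).
  have cvbe x : (fun n => v n x * (arcl (p n x))^-1 ^+ 5) @ U --> v' x * (arcl (p' x))^-1 ^+ 5.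
    apply: cvgM; first exact: cv.
    exact: (cvg_comp _ _ (cp x) (@arclVX_continuous R 5 (p' x))).
  have cvr i : (fun n => bend (v n) (p n) (node k i) *
       ((p n (node k i.+1) - p n (node k i)) ^+ 2 / mesh k)
       + inverse_area (v n) (p n) (node k i) * mesh k) @ U -->
      bend v' p' (node k i) * ((p' (node k i.+1) - p' (node k i)) ^+ 2 / mesh k)
       + inverse_area v' p' (node k i) * mesh k.
    apply: cvgD; last by apply: cvgM; [exact: cvia|exact: cvg_cst].
    apply: cvgM; first exact: cvbe.
    by apply: cvgM; [exact: cpX|exact: cvg_cst].
  apply: (ler_cvg_to (cvg_ord_sum (n := 2 ^ k) _ cvr) (cvg_cst (B + eta + eta * (K + 2)))).
  apply: ooU; apply: filterS (Henergy eta0) => n En.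
  apply: (le_trans (riemann_energy_le c0 (profile_pq (Hprof n)) (profile_q2 (Hprof n))
    (Hbound n) (ltW eta0) (mod _ _ (Hbound n)))).
  by rewrite lerD// ler_wpM2l ?(ltW eta0)// lerD2r.
have c1 : continuous (fun _ : R => 1 : R) by move=> t; exact: cvg_cst.
(* Weight 1 yields the square integrability that a profile requires. *)
have lq2 : locint (fun t => q' t ^+ 2).
  have [] := @itg_sqr_limit R (fun=> 1) (fun j => stepf p' (s j)) q' K c1 _ lq q0 fq => //.
  - by move=> j; exact: locint_stepf.
  - by move=> j; apply: locint_continuousM => //; exact: locint_stepf_sqr.
  - move=> e e0; exists 0%N => j _.
    rewrite (@eq_itg _ _ (fun t => stepf p' (s j) t ^+ 2)); last by move=> t _ _; rewrite mul1r.
    have := quot (s j); rewrite -quotient_energyE /quotient_energy; lra.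
  - by move=> + _; congr locint; apply/funext => t; rewrite mul1r.
(* The area term does not vary with the step function, so it is moved to the right and Fatou's lemma
   is applied to the curvature term alone. *)
have [la le_a] : locint (fun t => bend v' p' t * q' t ^+ 2) /\
    itg (fun t => bend v' p' t * q' t ^+ 2) (-1) 1 <= B - itg (inverse_area v' p') (-1) 1.
  apply: (@itg_sqr_limit R _ (fun j => stepf p' (s j)) q') => //.
  - by move=> t; exact: (bend_ge0 c0 _ Hb).
  - by move=> j; exact: locint_stepf.
  - by move=> j; apply: locint_continuousM => //; exact: locint_stepf_sqr.
  - move=> e e0; have [N HN] := energy_le _ e0.
    exists N => j Nj; have := HN (s j) (leq_trans Nj (sj j)); lra.
exists v', p', q'; split.
- split => //.
  + by move=> x xo; apply: (lim_eq _ _ _ (cv x)) => n; exact: (profile_v0 (Hprof n)).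
  + by move=> x; exact: lt_le_trans c0 (bp_v_ge Hb x).
  + move=> x; apply: (cvg_unique _ (cv (- x))) => //.
    rewrite (_ : (fun n => _) = v ^~ x); first exact: cv.
    by apply/funext => n; exact: (profile_even (Hprof n)).
  + move=> x; apply: (cvg_unique _ (cp (- x))) => //.
    rewrite (_ : (fun n => _) = (fun n => - p n x)); first by apply: cvgN; exact: cp.
    by apply/funext => n; exact: (profile_odd (Hprof n)).
- rewrite /energy (@eq_itg _ _ (fun t => bend v' p' t * q' t ^+ 2 + inverse_area v' p' t)); last first.
    by move=> t _ _; rewrite densityE.
  rewrite itgD//; last exact: locint_continuous.
  lra.
- by move=> x y; exact: lim_le (cv x).
Qed.

End Limit.
End Compactness.

(** * Existence of a minimizer below the energy threshold *)

Unset Implicit Arguments.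
Set Strict Implicit.

Theorem theorem1p3 (R : realType) (alpha : R) (psi : R -> R)
    (alpha_gt0 : 0 < alpha)
    (psi_cont : {within citv, continuous psi})
    (psi_gt0 : forall x, x \in citv -> 0 < psi x)
    (psi_bd : psi 1 = psi (-1) /\ alpha < psi (-1))
    (psi_even : forall x, x \in oitv -> psi x = psi (- x))
    (inf_lt : (ereal_inf [set Willmore v | v in obstacle_admissible alpha psi]
               < (4 * pi)%:E)%E) :
  exists u : R -> R, obstacle_admissible alpha psi u /\
    Willmore u = ereal_inf [set Willmore v | v in obstacle_admissible alpha psi].
Proof.
set S := [set Willmore v | v in obstacle_admissible alpha psi] in inf_lt *.
have pi2 : 0 < (pi / 2 : R) by rewrite divr_gt0 ?pi_gt0.
have rep w : obstacle_admissible alpha psi w -> exists f : (R -> R) * (R -> R) * (R -> R),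
    [/\ profile alpha f.1.1 f.1.2 f.2, {in citv, w =1 f.1.1} &
     Willmore w = (pi / 2 * energy f.1.1 f.1.2 f.2)%:E].
  move=> [/(admissible_profile alpha_gt0)[v [p [q [H wv]]]] _].
  exists (v, p, q); split => //; apply: (Willmore_profile H) => x xo; apply: wv.
  by move: xo; rewrite in_oitv in_citv => /andP[h1 h2]; rewrite !ltW.
have energy_ge0 v p q : profile alpha v p q -> 0 <= energy v p q.
  by move=> H; apply: itg_ge0 => t; exact/density_ge0/(profile_gt0 H).
have inf_ge0 : (0%:E <= ereal_inf S)%E.
  apply: le_ereal_inf_tmp => _ [w /rep[f [H _ ->]] <-].
  by rewrite lee_fin mulr_ge0 ?(ltW pi2)// (energy_ge0 _ _ _ H).
(* An empty infimum would be +oo; the strict bound excludes this and makes the infimum a real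
   number. *)
have inf_fin : ereal_inf S \is a fin_num.
  by rewrite ge0_fin_numE// (lt_trans inf_lt)// ltry.
pose B := fine (ereal_inf S) / (pi / 2).
have infE : ereal_inf S = (pi / 2 * B)%:E.
  by rewrite /B mulrC divfK ?gt_eqF// fineK.
have B8 : B < 8.
  move: inf_lt; rewrite infE lte_fin (_ : 4 * pi = pi / 2 * 8); last by field.
  by rewrite ltr_pM2l.
(* The midpoint of [B] and 8 is an energy bound below 8 that every term of the sequence can satisfy:
   [gap] starts at E - B and decreases to 0. *)
pose E := (B + 8) / 2; have E8 : E < 8 by rewrite /E; lra.
pose gap n := (E - B) / n.+1%:R.
have EB : 0 < E - B by rewrite /E; lra.
have seq n : exists f : (R -> R) * (R -> R) * (R -> R),
    [/\ profile alpha f.1.1 f.1.2 f.2, forall x, x \in citv -> f.1.1 x <= psi x &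
     energy f.1.1 f.1.2 f.2 <= B + gap n].
  have : (ereal_inf S < (pi / 2 * (B + gap n))%:E)%E.
    by rewrite infE lte_fin ltr_pM2l// ltrDl divr_gt0.
  move=> /ereal_inf_lt[_ [w aw <-]]; have [f [H wf ->]] := rep w aw.
  rewrite lte_fin ltr_pM2l// => lt; exists f; split => //; last exact: ltW.
  by move=> x xc; rewrite -wf//; exact: aw.2.
have [f Hf] := choice seq.
have Hprof n : profile alpha (f n).1.1 (f n).1.2 (f n).2 by case: (Hf n).
have [C [c [M [K [c0 bounds]]]]] := uniform_bounds alpha_gt0 E8.
have gapE n : B + gap n <= E.
  by rewrite -lerBrDl /gap ler_pdivrMr// -[leLHS]mulr1 ler_wpM2l ?(ltW EB)// ler1n.
have enE n : energy (f n).1.1 (f n).1.2 (f n).2 <= E.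
  by case: (Hf n) => _ _ /le_trans; apply; exact: gapE.
have {}bounds n := bounds _ _ _ (Hprof n) (enE n).
have Hbound n : bounded_profile C c M K (f n).1.1 (f n).1.2.
  by have [b1 b2 b3 b4] := bounds n; exact: (profile_bounded (Hprof n)).
have HqK n : itg (fun t => (f n).2 t ^+ 2) (-1) 1 <= K by case: (bounds n).
have Hen (e : R) : 0 < e ->
    \forall n \near \oo, energy (f n).1.1 (f n).1.2 (f n).2 <= B + e.
  move=> e0; near=> n; have [_ _ /le_trans] := Hf n; apply.
  rewrite lerD2l /gap ler_pdivrMr// mulrC -ler_pdivrMr//.
  apply: ltW; apply: (lt_le_trans (y := n%:R)); last by rewrite ler_nat.
  by near: n; exact: nbhs_infty_gtr.
have [v [p [q [H vB vpsi]]]] := minimizing_limit c0 Hprof Hbound HqK Hen.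
have vobs : obstacle_admissible alpha psi v.
  split; first exact: profile_admissible alpha_gt0 H.
  by move=> x xc; apply: vpsi => n; have [_ + _] := Hf n; exact.
exists v; split => //; apply/eqP; rewrite eq_le; apply/andP; split; last first.
  by apply: ereal_inf_lbound; exists v.
by rewrite (Willmore_profile H (fun x _ => erefl)) infE lee_fin ler_wpM2l// ltW.
Unshelve. all: by end_near. Qed.
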